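(* Let $V_2=\mathbb{Q}(i)^2$ be the standard representation of $GL_2(\mathbb{Z}[i])$. For every integer $n\ge0$, $\chi_h(GL_2(\mathbb{Z}[i]),S^nV_2)=1$ if $n\equiv0\pmod 4$ and $\chi_h(GL_2(\mathbb{Z}[i]),S^nV_2)=0$ otherwise.
   Context: $S^n$ denotes the $n$-th symmetric power (over $\mathbb{Q}(i)$), and $\chi_h(\Gamma,V)=\sum_j(-1)^j\dim_{\mathbb{Q}(i)}H^j(\Gamma,V)$. *)

(* Defs.v *)
From HB Require Import structures.
From mathcomp Require Import all_boot all_order all_algebra.
From mathcomp Require Import complex.
Set Implicit Arguments. Unset Strict Implicit. Unset Printing Implicit Defensive.
Import Order.TTheory GRing.Theory Num.Theory.
Local Open Scope ring_scope.

Notation Qi := (complex rat).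

Definition gauss_int (x : Qi) : Prop :=
  complex.Re x \is a Num.int /\ complex.Im x \is a Num.int.

Definition gauss_int_mx (g : 'M[Qi]_2) : Prop := forall i j, gauss_int (g i j).

Definition GL2Zi (g : 'M[Qi]_2) : Prop :=
  gauss_int_mx g /\ exists h, gauss_int_mx h /\ g *m h = 1%:M /\ h *m g = 1%:M.

(* S^n V_2, V_2 = Q(i)^2 with basis e1 e2 and g e_j = sum_i g_ij e_i.
   An element  sum_k v_k e1^(n-k) e2^k  is stored as the row vector v; dehomogenising
   (t = e2/e1) it is the polynomial sum_k v_k t^k, and g acts by
   e1 |-> g00 e1 + g10 e2, e2 |-> g01 e1 + g11 e2, i.e.
   g.v = sum_k v_k (g00 + g10 t)^(n-k) (g01 + g11 t)^k. *)
Definition symact (n : nat) (g : 'M[Qi]_2) (v : 'rV[Qi]_(n.+1)) : 'rV[Qi]_(n.+1) :=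
  \row_(l < n.+1)
    (\sum_(k < n.+1) v 0 k *:
        (((g ord_max ord0)%:P * 'X + (g ord0 ord0)%:P) ^+ (n - k)
         * ((g ord_max ord_max)%:P * 'X + (g ord0 ord_max)%:P) ^+ k))`_l.

(* Inhomogeneous cochains: a j-cochain is a function on j-lists of group elements
   (only its values on lists of length j with entries in Gamma matter). *)
Definition mergeAt (i : nat) (s : seq 'M[Qi]_2) : seq 'M[Qi]_2 :=
  take i s ++ (nth 1 s i * nth 1 s i.+1) :: drop i.+2 s.

Definition coboundary (V : lmodType Qi) (act : 'M[Qi]_2 -> V -> V) (j : nat)
    (c : seq 'M[Qi]_2 -> V) (s : seq 'M[Qi]_2) : V :=
  act (head 1 s) (c (behead s))
  + \sum_(i < j) (-1) ^+ i.+1 *: c (mergeAt i s)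
  + (-1) ^+ j.+1 *: c (take j s).

Definition onGamma (s : seq 'M[Qi]_2) : Prop := forall g, g \in s -> GL2Zi g.

Definition is_cocycle (V : lmodType Qi) (act : 'M[Qi]_2 -> V -> V) (j : nat)
    (c : seq 'M[Qi]_2 -> V) : Prop :=
  forall s, size s = j.+1 -> onGamma s -> coboundary act j c s = 0.

Definition is_coboundary (V : lmodType Qi) (act : 'M[Qi]_2 -> V -> V) (j : nat)
    (c : seq 'M[Qi]_2 -> V) : Prop :=
  if j is j'.+1 then
    exists b : seq 'M[Qi]_2 -> V,
      forall s, size s = j -> onGamma s -> c s = coboundary act j' b s
  else forall s, size s = 0%N -> c s = 0.

Definition H_dim (V : lmodType Qi) (act : 'M[Qi]_2 -> V -> V) (j d : nat) : Prop :=
  exists cs : 'I_d -> (seq 'M[Qi]_2 -> V),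
    (forall k, is_cocycle act j (cs k)) /\
    (forall a : 'I_d -> Qi,
        is_coboundary act j (fun s => \sum_(k < d) a k *: cs k s) -> forall k, a k = 0) /\
    (forall z, is_cocycle act j z ->
        exists a : 'I_d -> Qi,
          is_coboundary act j (fun s => z s - \sum_(k < d) a k *: cs k s)).

Definition euler_char_is (V : lmodType Qi) (act : 'M[Qi]_2 -> V -> V) (e : int) : Prop :=
  exists (N : nat) (dims : nat -> nat),
    (forall j, H_dim act j (dims j)) /\
    (forall j, (N < j)%N -> dims j = 0%N) /\
    e = \sum_(j < N.+1) (-1) ^+ j * (dims j)%:Z.

(* Main.v *)
From HB Require Import structures.
From Stdlib Require Import ZArith Classical ClassicalEpsilon FunctionalExtensionality PropExtensionality.
From Stdlib Require Import Relation_Operators Wellfounded.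
Require Import Defs.
From mathcomp Require Import all_boot all_order all_algebra.
From mathcomp Require Import complex ring lra zify ssrZ.
Set Implicit Arguments. Unset Strict Implicit. Unset Printing Implicit Defensive.
Import Order.TTheory GRing.Theory Num.Theory.
Local Open Scope ring_scope.

(* PGL_2(Z[i]) is the orientation preserving subgroup of the Coxeter group [3,4,4], and it acts
   on a contractible complex of triangles in hyperbolic 3-space (Mendoza's complex) with finite
   stabilisers: S4, S3, D4 for the vertices, C3, C2, C2 for the edges and 1 for the triangle.  With
   K running over their preimages in GL_2(Z[i]) and V a representation over Q(i), the complex of
   right-invariant functions 0 -> V -> (+) Map(G/K_vertex, V) -> (+) Map(G/K_edge, V)
   -> Map(G/Z, V) -> 0 is exact: ordering the triangles by their height above a generic point near
   a cusp, each triangle is the lowest one on at least one of its edges, and it is the lowest one at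
   a vertex as soon as it is so on the two edges there, so that sections can be built by
   well-founded recursion.  Averaging over K makes the Map(G/K, V) acyclic, hence H^* is computed
   by (+) V^K_vertex -> (+) V^K_edge -> V^Z and the Euler characteristic is the alternating sum of
   the dimensions of the V^K.  For V = S^n V_2 these are averages of traces; they vanish unless 4
   divides n because of the scalar i, and otherwise the contributions of the identity, of the
   elements of order 3 and of the involutions of determinant +-i cancel, while those of the elements
   of order 4 and of the involutions of determinant +-1 are 1/2 each. *)

(** The two edges at a vertex control its whole stabiliser because of Coxeter positivity. The
    triangle is the face on the unit hemisphere of the fundamental tetrahedron of [3,4,4], and the
    reference point [gX] in it is fixed by the reflection in that face. So the rotations around a
    vertex or an edge move [gX] to the same points as the full reflection group there, and each
    displacement is a combination of a few roots with coefficients in the natural numbers. Triangles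
    are compared by the sign of a displacement, and the positive displacements form a cone, so the
    signs of the roots decide minimality. Points are written as Hermitian forms over Z[i]: this
    makes displacements linear, and since the forms are integral and positive definite it makes the
    order well-founded. A lexicographic sign plays the role of the generic viewpoint; between
    triangles sharing a vertex it leaves no ties beyond those coming from scalars. *)

Local Notation G := 'M[Qi]_2.

(** * Group cohomology by a double complex *)

Lemma Qi_natr (n : nat) : n%:R = Complex n%:R 0 :> Qi.
Proof. by elim: n => [//|n IH]; rewrite -!natr1 IH; apply/eqP; rewrite eq_complex /= addr0 !eqxx. Qed.

Lemma Qi_natr_neq0 (n : nat) : (0 < n)%N -> n%:R != 0 :> Qi.
Proof. by move=> n0; rewrite Qi_natr eq_complex /= eqxx andbT pnatr_eq0 -lt0n. Qed.

Lemma gauss_int0 : gauss_int 0. Proof. by split; rewrite rpred0. Qed.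
Lemma gauss_int1 : gauss_int 1. Proof. by split; rewrite ?rpred1 ?rpred0. Qed.
Lemma gauss_intD x y : gauss_int x -> gauss_int y -> gauss_int (x + y).
Proof. by case: x y => [a b] [c d] [? ?] [? ?]; split; rewrite /= rpredD. Qed.
Lemma gauss_intM x y : gauss_int x -> gauss_int y -> gauss_int (x * y).
Proof.
by case: x y => [a b] [c d] [/= ? ?] [/= ? ?]; split; rewrite /= ?rpredB ?rpredD ?rpredM.
Qed.

Lemma gauss_int_mx1 : gauss_int_mx 1.
Proof. by move=> i j; rewrite mxE; case: eqP => _; [apply: gauss_int1|apply: gauss_int0]. Qed.

Lemma gauss_int_mxM g h : gauss_int_mx g -> gauss_int_mx h -> gauss_int_mx (g * h).
Proof.
move=> gi hi i j; rewrite mxE; elim/big_ind: _ => [|x y|k _].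
- exact: gauss_int0.
- exact: gauss_intD.
- exact: gauss_intM.
Qed.

Lemma GL2Zi_unit g : GL2Zi g -> g \is a GRing.unit.
Proof. by case=> _ [h [_ [gh hg]]]; apply/unitrP; exists h. Qed.

Lemma GL2Zi1 : GL2Zi 1.
Proof. by split; [exact: gauss_int_mx1|exists 1; split; [exact: gauss_int_mx1|rewrite !mulmx1]]. Qed.

Lemma GL2ZiM g h : GL2Zi g -> GL2Zi h -> GL2Zi (g * h).
Proof.
case=> gi [g' [gi' [gg' g'g]]] [hi [h' [hi' [hh' h'h]]]]; split; first exact: gauss_int_mxM.
exists (h' * g'); split; first exact: gauss_int_mxM.
rewrite -!mulmxE !mulmxA -(mulmxA g h h') hh' mulmx1 gg'.
by rewrite -(mulmxA h' g' g) g'g mulmx1 h'h.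
Qed.

Lemma GL2ZiV g : GL2Zi g -> GL2Zi g^-1.
Proof.
move=> Gg; have Ug := GL2Zi_unit Gg; case: Gg => gi [h [hi [gh hg]]].
have -> : g^-1 = h by apply: (mulrI Ug); rewrite mulrV //; symmetry; exact: gh.
by split=> //; exists g.
Qed.

Lemma onGamma_cons g s : onGamma (g :: s) <-> GL2Zi g /\ onGamma s.
Proof.
split=> [H|[Gg Gs] h].
  by split=> [|h hs]; apply: H; rewrite inE ?eqxx // hs orbT.
by rewrite inE => /orP[/eqP->|/Gs].
Qed.

Lemma onGamma_take j s : onGamma s -> onGamma (take j s).
Proof. by move=> H g /mem_take /H. Qed.

Lemma onGamma_mergeAt i s : (i.+1 < size s)%N -> onGamma s -> onGamma (mergeAt i s).
Proof.
move=> lis Gs g; rewrite /mergeAt mem_cat inE => /or3P[/mem_take/Gs//|/eqP->|/mem_drop/Gs//].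
by apply: GL2ZiM; apply: Gs; rewrite mem_nth // ltnW.
Qed.

Lemma size_mergeAt i s : (i.+1 < size s)%N -> size (mergeAt i s) = (size s).-1.
Proof.
move=> lis; rewrite /mergeAt size_cat /= size_take size_drop (ltnW lis).
by rewrite -addSnnS -(subnKC lis) addKn.
Qed.

Lemma mergeAtS i g s : mergeAt i.+1 (g :: s) = g :: mergeAt i s.
Proof. by []. Qed.

Lemma mergeAt0 g h s : mergeAt 0 [:: g, h & s] = g * h :: s.
Proof. by rewrite /mergeAt /= drop0. Qed.

(** Closure and inverses are not separate fields: they follow from the permutation of the list by
    left translations, which is the form in which averages use the group law. *)
Record fin_subgroup (K : seq G) : Prop := FinSubgroup {
  fin_subgroup1 : 1 \in K;
  fin_subgroup_GL : forall k, k \in K -> GL2Zi k;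
  fin_subgroup_perm : forall k, k \in K -> perm_eq [seq k * k' | k' <- K] K }.

Lemma fin_subgroup_trivial : fin_subgroup [:: 1].
Proof.
by split=> [|k|k]; rewrite inE ?eqxx // => /eqP->; [apply: GL2Zi1|rewrite /= mul1r].
Qed.

Inductive tri := T0 | T1 | T2.
Definition nxt i := match i with T0 => T1 | T1 => T2 | T2 => T0 end.
Definition tsum (V : nmodType) (f : tri -> V) := f T0 + f T1 + f T2.

Lemma subr_swap (V : zmodType) (a b c d : V) : a - b = c - d -> a - c = b - d.
Proof.
by move/eqP; rewrite subr_eq => /eqP->; rewrite addrC !addrA addNr add0r addrC.
Qed.

Lemma tsumB (V : zmodType) (f g : tri -> V) : tsum (fun i => f i - g i) = tsum f - tsum g.
Proof. by rewrite /tsum [X in X + _ = _]addrACA -opprD [LHS]addrACA -opprD. Qed.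

Lemma tsum_nxt (V : zmodType) (f : tri -> V) : tsum (fun i => f i - f (nxt i)) = 0.
Proof. by rewrite tsumB /tsum /= [X in _ - X]addrC addrA subrr. Qed.

Lemma tsum_comb (R : pzRingType) (V : lmodType R) a (f g : tri -> V) :
  tsum (fun i => f i + a *: g i) = tsum f + a *: tsum g.
Proof. by rewrite /tsum !scalerDr [X in X + _ = _]addrACA [LHS]addrACA. Qed.

Lemma functional_choice (A B : Type) (R : A -> B -> Prop) :
  (forall x, exists y, R x y) -> exists f, forall x, R x (f x).
Proof.
move=> H; pose w x := constructive_indefinite_description _ (H x).
by exists (fun x => proj1_sig (w x)) => x; apply: proj2_sig (w x).
Qed.

Section Average.
Variables (V : lmodType Qi) (K : seq G).
Hypothesis finK : fin_subgroup K.

Definition avg (f : G -> V) : V := (size K)%:R^-1 *: \sum_(k <- K) f k.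

Lemma eq_avg f f' : (forall k, k \in K -> f k = f' k) -> avg f = avg f'.
Proof. by move=> e; congr (_ *: _); rewrite !big_seq; apply: eq_bigr => k /e. Qed.

Lemma avg_const f v : (forall k, k \in K -> f k = v) -> avg f = v.
Proof.
move=> e; rewrite /avg big_seq (eq_bigr (fun=> v)) => [|k /e//].
rewrite -big_seq big_const_seq count_predT iter_addr_0 -[v *+ _]scaler_nat scalerA mulVf ?scale1r //.
by apply: Qi_natr_neq0; case: K (fin_subgroup1 finK).
Qed.

Lemma avg_translate f k : k \in K -> avg (fun k' => f (k * k')) = avg f.
Proof.
move=> kK; congr (_ *: _).
by rewrite -[RHS](perm_big _ (fin_subgroup_perm finK kK)) big_map.
Qed.

Lemma avgD f f' : avg (fun k => f k + f' k) = avg f + avg f'.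
Proof. by rewrite /avg big_split /= scalerDr. Qed.

Lemma avgZ a f : avg (fun k => a *: f k) = a *: avg f.
Proof. by rewrite /avg -scaler_sumr scalerA mulrC -scalerA. Qed.

Lemma avg_sum n (f : 'I_n -> G -> V) : avg (fun k => \sum_(i < n) f i k) = \sum_(i < n) avg (f i).
Proof. by rewrite /avg exchange_big /= scaler_sumr. Qed.

End Average.

(** * Acyclicity of the module of functions on G/K *)

Section Cochains.
Variables (V : lmodType Qi) (act : G -> V -> V).
Local Hint Resolve GL2Zi1 GL2ZiM GL2ZiV GL2Zi_unit : core.
Hypothesis act_linear : forall g, linear (act g).
Hypothesis act1 : forall v, act 1 v = v.
Hypothesis actM : forall g h v, act (g * h) v = act g (act h v).

HB.instance Definition _ g := GRing.isLinear.Build Qi V V _ (act g) (act_linear g).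

Lemma actVK g v : GL2Zi g -> act g (act g^-1 v) = v.
Proof. by move=> /GL2Zi_unit Ug; rewrite -actM mulrV. Qed.

Lemma actKV g v : GL2Zi g -> act g^-1 (act g v) = v.
Proof. by move=> /GL2Zi_unit Ug; rewrite -actM mulVr. Qed.

Lemma act_inj g u v : GL2Zi g -> act g u = act g v -> u = v.
Proof. by move=> Gg /(congr1 (act g^-1)); rewrite !actKV. Qed.

(* Cochains with values in the module of all functions G -> V, on which g acts by
   (g F) x = g (F (g^-1 x)). *)
Definition dcol (j : nat) (c : seq G -> G -> V) (s : seq G) (x : G) : V :=
  act (head 1 s) (c (behead s) ((head 1 s)^-1 * x))
  + \sum_(i < j) (-1) ^+ i.+1 *: c (mergeAt i s) x
  + (-1) ^+ j.+1 *: c (take j s) x.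

(** The complex of V sits inside the function-valued one as the constant functions, for which the
    inner translation by the inverse of g is invisible. *)
Lemma dcol_const j c s x : dcol j (fun s _ => c s) s x = coboundary act j c s.
Proof. by []. Qed.

Definition eqc j (c c' : seq G -> G -> V) :=
  forall s x, size s = j -> onGamma s -> GL2Zi x -> c s x = c' s x.

Lemma dcol_eqc j c c' : eqc j c c' -> eqc j.+1 (dcol j c) (dcol j c').
Proof.
move=> e [//|g s] x /= [sz] /[dup] Ggs /onGamma_cons[Gg Gs] Gx.
rewrite /dcol /= e //; last by auto.
congr (_ + _ + _ *: _).
- apply: eq_bigr => i _; rewrite e //.
    by rewrite size_mergeAt /= sz // ltnS.
  by apply: onGamma_mergeAt; rewrite //= sz ltnS.
- by apply: e => //; [rewrite size_take /= sz ltnSn|apply: onGamma_take].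
Qed.

Lemma dcolD j c c' s x : dcol j (fun s x => c s x + c' s x) s x = dcol j c s x + dcol j c' s x.
Proof.
rewrite /dcol linearD /= scalerDr.
under eq_bigr do rewrite scalerDr.
rewrite big_split /= [X in X + _ = _]addrACA [LHS]addrACA.
by [].
Qed.

Lemma dcolN j c s x : dcol j (fun s x => - c s x) s x = - dcol j c s x.
Proof.
rewrite /dcol linearN /= scalerN !opprD; congr (_ + _ + _).
by rewrite -sumrN; apply: eq_bigr => i _; rewrite scalerN.
Qed.

Lemma dcol0 j s x : dcol j (fun _ _ => 0) s x = 0.
Proof.
by rewrite /dcol linear0 scaler0 addr0 add0r big1 // => i _; rewrite scaler0.
Qed.

Lemma dcolZ j a c s x : dcol j (fun s x => a *: c s x) s x = a *: dcol j c s x.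
Proof.
rewrite /dcol linearZ /= !scalerDr scaler_sumr !scalerA [a * _]mulrC -scalerA; congr (_ + _ + _).
by apply: eq_bigr => i _; rewrite !scalerA mulrC.
Qed.

Lemma dcolB j c c' s x : dcol j (fun s x => c s x - c' s x) s x = dcol j c s x - dcol j c' s x.
Proof. by rewrite (dcolD j c (fun s x => - c' s x)) dcolN. Qed.

Lemma dcol_sub j c c' : eqc j.+1 (dcol j c) (dcol j c') ->
  eqc j.+1 (dcol j (fun s x => c s x - c' s x)) (fun _ _ => 0).
Proof. by move=> e s x sz Gs Gx; rewrite dcolB e // subrr. Qed.

Definition rinv (K : seq G) (F : G -> V) :=
  forall x k, GL2Zi x -> k \in K -> F (x * k) = F x.

Definition rinvc K j (c : seq G -> G -> V) :=
  forall s, size s = j -> onGamma s -> rinv K (c s).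

Lemma rinvcB K j c c' : rinvc K j c -> rinvc K j c' -> rinvc K j (fun s x => c s x - c' s x).
Proof. by move=> ic ic' s sz Gs x k Gx kK; rewrite ic ?ic'. Qed.

Lemma rinvc_sub K K' j c : {subset K <= K'} -> rinvc K' j c -> rinvc K j c.
Proof. by move=> sK ic s sz Gs x k Gx kK; apply: ic => //; apply: sK. Qed.

Lemma rinvc_dcol K j c : rinvc K j c -> rinvc K j.+1 (dcol j c).
Proof.
move=> ic [//|g s] /= [sz] /[dup] Ggs /onGamma_cons[Gg Gs] x k Gx kK.
rewrite /dcol /= mulrA (ic s) //; last by auto.
congr (_ + _ + _ *: _).
- apply: eq_bigr => i _; rewrite ic //.
    by rewrite size_mergeAt /= sz // ltnS.
  by apply: onGamma_mergeAt; rewrite //= sz ltnS.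
- by apply: ic => //; [rewrite size_take /= sz ltnSn|apply: onGamma_take].
Qed.

(* In homogeneous coordinates: insert x k as a new first argument and average over k. *)
Definition hcol (K : seq G) (c : seq G -> G -> V) (s : seq G) (x : G) : V :=
  avg K (fun k => act (x * k) (c ((x * k)^-1 :: s) 1)).

Lemma rinvc_hcol K j c : fin_subgroup K -> rinvc K j (hcol K c).
Proof.
move=> fK s _ _ x k _ kK; rewrite /hcol.
rewrite -(avg_translate fK (fun k => act (x * k) (c ((x * k)^-1 :: s) 1)) kK).
by apply: eq_avg => k' _; rewrite mulrA.
Qed.

Lemma act_avg K g f : act g (avg K f) = avg K (fun k => act g (f k)).
Proof. by rewrite /avg linearZ linear_sum. Qed.

(** Each summand k of the averages already gives [c s x]: the leading term of d c, evaluated after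
    inserting the inverse of x k, is [c s (x * k)], equal to [c s x] by right invariance, and all
    other terms cancel against those of d h c. *)
Lemma hcol_homotopy K j c : fin_subgroup K -> rinvc K j.+1 c ->
  eqc j.+1 (fun s x => dcol j (hcol K c) s x + hcol K (dcol j.+1 c) s x) c.
Proof.
move=> fK ic [//|g s] x sz /[dup] Ggs /onGamma_cons[Gg Gs] Gx.
have Ug := GL2Zi_unit Gg; have Ux := GL2Zi_unit Gx.
rewrite {1}/dcol /= {1}/hcol act_avg.
under [X in _ + X + _ + _]eq_bigr => i _ do rewrite -avgZ.
rewrite -(@avg_sum V K) -avgZ -!avgD.
apply: (avg_const fK) => k kK; have Gk := fin_subgroup_GL fK kK; have Uk := GL2Zi_unit Gk.
set a := (x * k)^-1; have Ga : GL2Zi a by apply/GL2ZiV/GL2ZiM.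
have Ea : x * k = a^-1 by rewrite invrK.
rewrite {1}/dcol /= big_ord_recl mergeAt0 mulr1 expr1 scaleN1r.
have Uxk : x * k \is a GRing.unit by apply/GL2Zi_unit/GL2ZiM.
have -> : (g^-1 * x * k)^-1 = a * g by rewrite /a -mulrA invrM ?invrK // unitrV.
rewrite -actM !mulrA mulrV // mul1r -Ea.
rewrite !linearD linearN /= actVK ?ic //; last exact: GL2ZiM.
rewrite linear_sum linearZ /=.
have -> : \sum_(i < j) act (x * k) ((-1) ^+ i.+2 *: c (mergeAt i.+1 [:: a, g & s]) 1) =
  - \sum_(i < j) (-1) ^+ i.+1 *: act (x * k) (c (a :: mergeAt i (g :: s)) 1).
  rewrite -sumrN; apply: eq_bigr => i _.
  by rewrite linearZ /= mergeAtS exprS mulN1r scaleNr.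
rewrite [(-1) ^+ j.+2]exprS mulN1r scaleNr.
set A := act _ _; set B := \sum_(i < j) _; set C := _ *: _.
by rewrite -opprD -[_ - (A + B) - C]addrA -opprD [LHS]addrC subrK.
Qed.

Lemma hcol1 c s x : hcol [:: 1] c s x = act x (c (x^-1 :: s) 1).
Proof. by rewrite /hcol /avg /= big_seq1 invr1 scale1r mulr1. Qed.

Lemma rinvc1 j c : rinvc [:: 1] j c.
Proof. by move=> s _ _ x k _; rewrite inE => /eqP->; rewrite mulr1. Qed.

Lemma dcol_act v s x : size s = 1%N -> onGamma s -> GL2Zi x -> dcol 0 (fun _ x => act x v) s x = 0.
Proof.
case: s => [//|g [|//]] _ /onGamma_cons[Gg _] Gx.
by rewrite /dcol /= big_ord0 addr0 expr1 scaleN1r actM actVK // subrr.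
Qed.

(* The homotopy gives h d d = d d h = 0 by induction on the degree, and h is
   injective on values at 1. *)
Lemma dcol_dcol j c : eqc j.+2 (dcol j.+1 (dcol j c)) (fun _ _ => 0).
Proof.
have tr i d s x y : dcol i (fun s y => d s (y * x)) s y = dcol i d s (y * x).
  by rewrite /dcol mulrA.
have step i : (forall d, eqc i.+1 (hcol [:: 1] (dcol i.+1 (dcol i d))) (fun _ _ => 0)) ->
    forall d, eqc i.+2 (dcol i.+1 (dcol i d)) (fun _ _ => 0).
  move=> H d [//|g s] x [sz] /[dup] Ggs /onGamma_cons[Gg Gs] Gx.
  rewrite -[x in LHS]mul1r -tr.
  rewrite (@dcol_eqc i.+1 _ (dcol i (fun s y => d s (y * x)))) //=; last by rewrite sz.
  have := H (fun s y => d s (y * x)) s g^-1 sz Gs (GL2ZiV Gg).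
  by rewrite hcol1 invrK -[RHS](linear0 (act g^-1)) => /(act_inj (GL2ZiV Gg)).
elim: j c => [|j IH] c; apply: step => {c} c s x sz Gs Gx.
- have := hcol_homotopy fin_subgroup_trivial (@rinvc1 1 (dcol 0 c)) sz Gs Gx.
  move=> /(canRL (addKr _)) ->; apply/eqP; rewrite addrC subr_eq0; apply/eqP.
  have e : eqc 0 (hcol [:: 1] (dcol 0 c)) (fun s x => c s x - act x (c [::] 1)).
    move=> s' x' /size0nil-> _ Gx'.
    rewrite hcol1 /dcol /= big_ord0 addr0 expr1 scaleN1r mulr1 invrK.
    by rewrite linearB /= actVK.
  rewrite (dcol_eqc e sz Gs Gx) dcolB dcol_act ?subr0 //.
- have := hcol_homotopy fin_subgroup_trivial (@rinvc1 j.+2 (dcol j.+1 c)) sz Gs Gx.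
  move=> /(canRL (addKr _)) ->; apply/eqP; rewrite addrC subr_eq0; apply/eqP.
  have e : eqc j.+1 (hcol [:: 1] (dcol j.+1 c))
                    (fun s x => c s x - dcol j (hcol [:: 1] c) s x).
    move=> s' x' sz' Gs' Gx'.
    have := hcol_homotopy fin_subgroup_trivial (@rinvc1 j.+1 c) sz' Gs' Gx'.
    by move=> /(canRL (addKr _)) ->; rewrite addrC.
  by rewrite (dcol_eqc e sz Gs Gx) dcolB (IH _ _ _ sz Gs Gx) subr0.
Qed.

Lemma eqc_sym j c1 c2 : eqc j c1 c2 -> eqc j c2 c1.
Proof. by move=> e s x sz Gs Gx; rewrite e. Qed.

Definition fixed_by (K : seq G) (v : V) := forall k, k \in K -> act k v = v.

(** This is Map(G/K, V)^G = V^K: an invariant function satisfies F(x) = x F(1), and right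
    K-invariance then says that K fixes F(1). *)
Lemma dcol_exact0 K c : fin_subgroup K -> rinvc K 0 c -> eqc 1 (dcol 0 c) (fun _ _ => 0) ->
  exists v, fixed_by K v /\ forall x, GL2Zi x -> c [::] x = act x v.
Proof.
move=> fK ic e; have E x : GL2Zi x -> c [::] x = act x (c [::] 1).
  move=> Gx; have := e [:: x] x erefl _ Gx; rewrite /dcol /= big_ord0 addr0 expr1 scaleN1r.
  rewrite mulVr ?GL2Zi_unit // => H; apply/esym/eqP; rewrite -subr_eq0; apply/eqP/H.
  by apply/onGamma_cons; split=> // y.
exists (c [::] 1); split=> // k kK.
rewrite -E; last exact: (fin_subgroup_GL fK).
by rewrite -[k]mul1r ic.
Qed.

Lemma dcol_exact K j c : fin_subgroup K -> rinvc K j.+1 c ->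
  eqc j.+2 (dcol j.+1 c) (fun _ _ => 0) ->
  exists b, rinvc K j b /\ eqc j.+1 (dcol j b) c.
Proof.
move=> fK ic e; exists (hcol K c); split; first exact: rinvc_hcol.
move=> s x sz Gs Gx; rewrite -[RHS](hcol_homotopy fK ic sz Gs Gx) -[LHS]addr0.
congr (_ + _); symmetry; apply: (avg_const fK) => k kK.
have Ga : GL2Zi (x * k) by apply: GL2ZiM => //; apply: (fin_subgroup_GL fK).
by rewrite e ?linear0 //= ?sz //; apply/onGamma_cons; split; auto.
Qed.

Lemma rinvc_const K j (z : seq G -> V) : rinvc K j (fun s _ => z s).
Proof. by []. Qed.

(** * The zigzag through the vertices, edges and interior of the triangle *)

Section Triangle.
(* Vertex i lies on the edges i and i - 1 mod 3; edge i joins the vertices i and i + 1. *)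
Variables (KV KE : tri -> seq G) (KZ : seq G).
Hypothesis fKV : forall i, fin_subgroup (KV i).
Hypothesis fKE : forall i, fin_subgroup (KE i).
Hypothesis fKZ : fin_subgroup KZ.
Hypothesis sKEV : forall i, {subset KE i <= KV i}.
Hypothesis sKEV' : forall i, {subset KE i <= KV (nxt i)}.
Hypothesis sKZE : forall i, {subset KZ <= KE i}.
Hypothesis E0 : forall F : G -> V, (forall i, rinv (KV i) F) -> forall x, GL2Zi x -> F x = F 1.
Hypothesis E1 : forall f : tri -> G -> V, (forall i, rinv (KE i) (f i)) ->
  (forall x, GL2Zi x -> tsum (f^~ x) = 0) ->
  exists F : tri -> G -> V, (forall i, rinv (KV i) (F i)) /\
    forall i x, GL2Zi x -> f i x = F i x - F (nxt i) x.
Hypothesis E2 : forall f : G -> V, rinv KZ f ->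
  exists F : tri -> G -> V, (forall i, rinv (KE i) (F i)) /\
    forall x, GL2Zi x -> f x = tsum (F^~ x).

(** An inhomogeneous cochain is an arbitrary function of the list [s], so exactness can be applied
    for each [s] separately and the solutions chosen independently, with no equivariance to
    respect. *)
Lemma E1_cochain j (f : tri -> seq G -> G -> V) : (forall i, rinvc (KE i) j (f i)) ->
  eqc j (fun s x => tsum (fun i => f i s x)) (fun _ _ => 0) ->
  exists F : tri -> seq G -> G -> V, (forall i, rinvc (KV i) j (F i)) /\
    forall i, eqc j (f i) (fun s x => F i s x - F (nxt i) s x).
Proof.
move=> fi f0.
have : forall s, exists F : tri -> G -> V, size s = j -> onGamma s ->
   (forall i, rinv (KV i) (F i)) /\ forall i x, GL2Zi x -> f i s x = F i x - F (nxt i) x.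
  move=> s; have [[sz Gs]|N] := excluded_middle_informative (size s = j /\ onGamma s).
    have [|x Gx|F HF] := E1 (f := fun i => f i s); last by exists F.
      by move=> i; apply: fi.
    exact: f0.
  by exists (fun _ _ => 0) => sz Gs; case: N.
case/functional_choice => F HF; exists (fun i s => F s i); split=> i s.
  by move=> sz Gs; case: (HF s sz Gs).
by move=> x sz Gs Gx; case: (HF s sz Gs) => _; apply.
Qed.

Lemma E2_cochain j f : rinvc KZ j f ->
  exists F : tri -> seq G -> G -> V, (forall i, rinvc (KE i) j (F i)) /\
    eqc j f (fun s x => tsum (fun i => F i s x)).
Proof.
move=> fi.
have : forall s, exists F : tri -> G -> V, size s = j -> onGamma s ->
   (forall i, rinv (KE i) (F i)) /\ forall x, GL2Zi x -> f s x = tsum (F^~ x).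
  move=> s; have [[sz Gs]|N] := excluded_middle_informative (size s = j /\ onGamma s).
    have [|F HF] := E2 (f := f s); last by exists F.
    exact: fi.
  by exists (fun _ _ => 0) => sz Gs; case: N.
case/functional_choice => F HF; exists (fun i s => F s i); split=> [i|] s.
  by move=> sz Gs; case: (HF s sz Gs).
by move=> x sz Gs Gx; case: (HF s sz Gs) => _; apply.
Qed.

Lemma eqc_tri j (c : tri -> seq G -> G -> V) :
  (forall i, eqc j (c i) (c (nxt i))) -> forall i i', eqc j (c i) (c i').
Proof.
move=> e; have e01 := e T0; have e12 := e T1; have e20 := e T2.
by case; case=> // s x sz Gs Gx; rewrite ?(e01 s) ?(e12 s) ?(e20 s) // ?(e01 s).
Qed.

Lemma E0_cochain j (c : tri -> seq G -> G -> V) : (forall i, rinvc (KV i) j (c i)) ->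
  (forall i, eqc j (c i) (c (nxt i))) -> forall i, eqc j (c i) (fun s _ => c T0 s 1).
Proof.
move=> ci /eqc_tri e i s x sz Gs Gx; rewrite (e _ T0) //; apply: E0 => // i' y k Gy kK.
rewrite !(e T0 i') //; first exact: ci.
by apply: GL2ZiM => //; apply: (fin_subgroup_GL (fKV i')).
Qed.

(** When the three lifts agree, their common value is invariant under all vertex groups, hence
    constant in x, and so is a cochain with values in V. *)
Lemma coboundary_of_equal j z (u : tri -> seq G -> G -> V) :
  (forall i, rinvc (KV i) j (u i)) ->
  (forall i, eqc j.+1 (dcol j (u i)) (fun s _ => z s)) ->
  (forall i, eqc j (u i) (u (nxt i))) -> is_coboundary act j.+1 z.
Proof.
move=> ui du /(E0_cochain ui) /(_ T0) e; exists (fun s => u T0 s 1) => s sz Gs.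
by rewrite -(du T0 s 1) // (dcol_eqc e).
Qed.

Lemma cocycle_of_equal j (u : tri -> seq G -> G -> V) :
  (forall i, rinvc (KV i) j (u i)) ->
  (forall i, eqc j.+1 (dcol j (u i)) (dcol j (u (nxt i)))) ->
  exists z, is_cocycle act j.+1 z /\ forall i, eqc j.+1 (dcol j (u i)) (fun s _ => z s).
Proof.
move=> ui du; have e := E0_cochain (fun i => rinvc_dcol (ui i)) du.
exists (fun s => dcol j (u T0) s 1); split=> // s sz Gs.
by rewrite -(dcol_const _ _ _ 1) -(dcol_eqc (e T0)) // dcol_dcol.
Qed.

(** As the [w i] sum to zero they are differences of functions [W i] at the vertices; subtracting d
    W_i from [u i] makes the lifts agree and leaves d u_i unchanged. *)
Lemma zigzag_coboundary j z (u w : tri -> seq G -> G -> V) :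
  (forall i, rinvc (KV i) j.+1 (u i)) -> (forall i, rinvc (KE i) j (w i)) ->
  (forall i, eqc j.+2 (dcol j.+1 (u i)) (fun s _ => z s)) ->
  (forall i, eqc j.+1 (fun s x => u i s x - u (nxt i) s x) (dcol j (w i))) ->
  eqc j (fun s x => tsum (fun i => w i s x)) (fun _ _ => 0) -> is_coboundary act j.+2 z.
Proof.
move=> ui wi du duw w0; have [W [Wi Ww]] := E1_cochain wi w0.
apply: (coboundary_of_equal (u := fun i s x => u i s x - dcol j (W i) s x)).
- by move=> i; apply: rinvcB => //; apply: rinvc_dcol.
- by move=> i s x sz Gs Gx; rewrite dcolB dcol_dcol // subr0 du.
- move=> i s x sz Gs Gx; apply: subr_swap.
  by have := duw i s x sz Gs Gx; rewrite (dcol_eqc (Ww i)) // dcolB.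
Qed.

Lemma cocycle_dcol j z : is_cocycle act j z -> eqc j.+1 (dcol j (fun s _ => z s)) (fun _ _ => 0).
Proof. by move=> zz s x sz Gs _; rewrite dcol_const zz. Qed.

Lemma cocycle_lift j z : is_cocycle act j.+1 z ->
  exists u : tri -> seq G -> G -> V, (forall i, rinvc (KV i) j (u i)) /\
    forall i, eqc j.+1 (dcol j (u i)) (fun s _ => z s).
Proof.
move=> /cocycle_dcol zz.
have [u Hu] := functional_choice (fun i => dcol_exact (fKV i) (@rinvc_const (KV i) _ z) zz).
by exists u; split=> i; case: (Hu i).
Qed.

Lemma diff_lift j z (u : tri -> seq G -> G -> V) :
  (forall i, rinvc (KV i) j (u i)) -> (forall i, eqc j.+1 (dcol j (u i)) (fun s _ => z s)) ->
  (forall i, rinvc (KE i) j (fun s x => u i s x - u (nxt i) s x)) /\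
  (forall i, eqc j.+1 (dcol j (fun s x => u i s x - u (nxt i) s x)) (fun _ _ => 0)).
Proof.
move=> ui du; split=> i.
  by apply: rinvcB; [apply: rinvc_sub (ui i)|apply: rinvc_sub (ui (nxt i))].
by apply: dcol_sub => s x sz Gs Gx; rewrite !du.
Qed.

Lemma cocycle_lift2 j z : is_cocycle act j.+2 z ->
  exists u w : tri -> seq G -> G -> V,
  [/\ forall i, rinvc (KV i) j.+1 (u i), forall i, rinvc (KE i) j (w i),
    forall i, eqc j.+2 (dcol j.+1 (u i)) (fun s _ => z s),
    forall i, eqc j.+1 (fun s x => u i s x - u (nxt i) s x) (dcol j (w i)) &
    eqc j.+1 (dcol j (fun s x => tsum (fun i => w i s x))) (fun _ _ => 0)].
Proof.
move=> /cocycle_lift[u [ui du]]; have [di dd] := diff_lift ui du.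
have [w Hw] := functional_choice (fun i => dcol_exact (fKE i) (di i) (dd i)).
exists u, w; split=> //; try by move=> i; case: (Hw i).
- by move=> i; apply: eqc_sym; case: (Hw i).
- move=> s x sz Gs Gx; rewrite /tsum !dcolD.
  by rewrite (Hw T0).2 // (Hw T1).2 // (Hw T2).2 //; apply: (tsum_nxt (fun i => u i s x)).
Qed.

Lemma rinvc_tsum j (w : tri -> seq G -> G -> V) : (forall i, rinvc (KE i) j (w i)) ->
  rinvc KZ j (fun s x => tsum (fun i => w i s x)).
Proof.
by move=> wi s sz Gs x k Gx kK; rewrite /tsum !wi //; apply: sKZE.
Qed.

(** In these degrees the closed sum of the [w i] is itself some d t. Splitting t over the three
    edges and subtracting the coboundaries of the pieces makes the sum zero, so no obstruction is
    left at the end of the zigzag. *)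
Lemma cohomology_vanishing j z : is_cocycle act j.+3 z -> is_coboundary act j.+3 z.
Proof.
move=> /cocycle_lift2[u [w [ui wi du duw dw]]].
have [t [ti dt]] := dcol_exact fKZ (rinvc_tsum wi) dw.
have [t' [ti' tt']] := E2_cochain ti.
apply: (zigzag_coboundary (u := u) (w := fun i s x => w i s x - dcol j (t' i) s x)) => //.
- by move=> i; apply: rinvcB => //; apply: rinvc_dcol.
- by move=> i s x sz Gs Gx; rewrite dcolB dcol_dcol // subr0 duw.
- move=> s x sz Gs Gx; rewrite tsumB -dt // (dcol_eqc tt') //.
  by rewrite /tsum !dcolD subrr.
Qed.

(** In degrees 0, 1, 2, [y] is what the zigzag of a cocycle [z] ends in: vectors attached to the
    vertices, to the edges, or to the triangle. These are relations and not maps because the lifts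
    [u] and [w] are not unique. *)
Definition rel0 (z : seq G -> V) (y : tri -> V) := forall i, y i = z [::].

Definition rel1 (z : seq G -> V) (y : tri -> V) :=
  exists u : tri -> seq G -> G -> V,
  [/\ forall i, rinvc (KV i) 0 (u i), forall i, eqc 1 (dcol 0 (u i)) (fun s _ => z s) &
    forall i, eqc 0 (fun s x => u i s x - u (nxt i) s x) (fun _ x => act x (y i))].

Definition rel2 (z : seq G -> V) (y : V) :=
  exists u w : tri -> seq G -> G -> V,
  [/\ forall i, rinvc (KV i) 1 (u i), forall i, rinvc (KE i) 0 (w i),
    forall i, eqc 2 (dcol 1 (u i)) (fun s _ => z s),
    forall i, eqc 1 (fun s x => u i s x - u (nxt i) s x) (dcol 0 (w i)) &
    eqc 0 (fun s x => tsum (fun i => w i s x)) (fun _ x => act x y)].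

Lemma rinv_act K v : fixed_by K v -> rinv K (fun x => act x v).
Proof. by move=> fv x k Gx kK; rewrite actM fv. Qed.

Lemma rinvc_act K j v : fixed_by K v -> rinvc K j (fun _ x => act x v).
Proof. by move=> fv s _ _; apply: rinv_act. Qed.

Lemma rel0_ex z : is_cocycle act 0 z ->
  exists y, [/\ rel0 z y, forall i, fixed_by (KV i) (y i) & forall i, y i = y (nxt i)].
Proof.
move=> zz; exists (fun=> z [::]); split=> // i k kK.
have := zz [:: k] erefl; rewrite /coboundary /= big_ord0 addr0 expr1 scaleN1r => /(_ _)/eqP.
rewrite subr_eq0 => H; apply/eqP/H.
by apply/onGamma_cons; split=> //; apply: (fin_subgroup_GL (fKV i)).
Qed.

Lemma rel0_cocycle y : (forall i, fixed_by (KV i) (y i)) -> (forall i, y i = y (nxt i)) ->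
  exists z, is_cocycle act 0 z /\ rel0 z y.
Proof.
move=> fy ey; have e i : y i = y T0 by case: i; rewrite // -[RHS](ey T2) ?(ey T1).
exists (fun=> y T0); split=> // -[//|g [|//]] _ /onGamma_cons[Gg _].
rewrite /coboundary /= big_ord0 addr0 expr1 scaleN1r.
rewrite (E0 (F := fun x => act x (y T0))) ?act1 ?subrr // => i.
by apply: rinv_act; rewrite -(e i).
Qed.

Lemma rel0_coboundary z y : rel0 z y -> is_coboundary act 0 z <-> forall i, y i = 0.
Proof.
move=> r; split=> [H i|H s /size0nil->]; first by rewrite r H.
by rewrite -(r T0) H.
Qed.

Lemma rel1_ex z : is_cocycle act 1 z ->
  exists y, [/\ rel1 z y, forall i, fixed_by (KE i) (y i) & tsum y = 0].
Proof.
move=> /cocycle_lift[u [ui du]]; have [di dd] := diff_lift ui du.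
have [y Hy] := functional_choice (fun i => dcol_exact0 (fKE i) (di i) (dd i)).
exists y; split.
- exists u; split=> // i s x /size0nil-> _ Gx; by case: (Hy i) => _ ->.
- by move=> i; case: (Hy i).
- rewrite /tsum -(act1 (y T0)) -(act1 (y T1)) -(act1 (y T2)).
  by rewrite -(Hy T0).2 // -(Hy T1).2 // -(Hy T2).2 //; apply: (tsum_nxt (fun i => u i [::] 1)).
Qed.

(** The zigzag read backwards: the functions x |-> x y_i sum to zero, so they are differences of
    some [U i]; being closed, they force the d U_i to agree, and the common value is [z]. *)
Lemma rel1_cocycle y : (forall i, fixed_by (KE i) (y i)) -> tsum y = 0 ->
  exists z, is_cocycle act 1 z /\ rel1 z y.
Proof.
move=> fy y0.
have [||U [Ui HU]] := @E1_cochain 0 (fun i _ x => act x (y i)).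
- by move=> i; apply: rinvc_act.
- by move=> s x sz Gs Gx; rewrite /tsum -!linearD /= -/(tsum y) y0 linear0.
have [i|z [zz dz]] := cocycle_of_equal Ui.
  move=> s x sz Gs Gx; apply/eqP; rewrite -subr_eq0 -dcolB.
  by rewrite -(dcol_eqc (HU i)) // dcol_act.
by exists z; split=> //; exists U; split=> // i; apply: eqc_sym.
Qed.

Lemma rel1_coboundary z y : rel1 z y ->
  is_coboundary act 1 z <-> exists v, (forall i, fixed_by (KV i) (v i)) /\
    forall i, y i = v i - v (nxt i).
Proof.
case=> u [ui du uy]; split=> [[b zb]|[v [fv yv]]].
- have ei i : eqc 1 (dcol 0 (fun s x => u i s x - b s)) (fun _ _ => 0).
    by apply: dcol_sub => s x sz Gs Gx; rewrite du // dcol_const -zb.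
  have ii i : rinvc (KV i) 0 (fun s x => u i s x - b s) by apply: rinvcB.
  have [v Hv] := functional_choice (fun i => dcol_exact0 (fKV i) (ii i) (ei i)).
  exists v; split=> i; first by case: (Hv i).
  rewrite -(act1 (y i)) -(uy i [::]) // -(act1 (v i)) -(act1 (v (nxt i))).
  by rewrite -(Hv i).2 // -(Hv (nxt i)).2 // opprB addrA subrK.
- apply: (coboundary_of_equal (u := fun i s x => u i s x - act x (v i))).
  + by move=> i; apply: rinvcB => //; apply: rinvc_act.
  + by move=> i s x sz Gs Gx; rewrite dcolB dcol_act // subr0 du.
  + move=> i s x sz Gs Gx; apply: subr_swap.
    by have := uy i s x sz Gs Gx; rewrite yv linearB.
Qed.

Lemma rel2_ex z : is_cocycle act 2 z -> exists y, rel2 z y /\ fixed_by KZ y.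
Proof.
move=> /cocycle_lift2[u [w [ui wi du duw dw]]].
have [y [fy Hy]] := dcol_exact0 fKZ (rinvc_tsum wi) dw.
exists y; split=> //; exists u, w; split=> // s x /size0nil-> _ Gx; exact: Hy.
Qed.

Lemma rel2_cocycle y : fixed_by KZ y -> exists z, is_cocycle act 2 z /\ rel2 z y.
Proof.
move=> fy; have [t [ti ty]] := E2_cochain (@rinvc_act KZ 0 y fy).
have [||U [Ui HU]] := @E1_cochain 1 (fun i => dcol 0 (t i)).
- by move=> i; apply: rinvc_dcol.
- by move=> s x sz Gs Gx; rewrite /tsum -!dcolD -(dcol_eqc ty) // dcol_act.
have [i|z [zz dz]] := cocycle_of_equal Ui.
  move=> s x sz Gs Gx; apply/eqP; rewrite -subr_eq0 -dcolB.
  by rewrite -(dcol_eqc (HU i)) // dcol_dcol.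
exists z; split=> //; exists U, t; split=> //; last exact: eqc_sym.
by move=> i; apply: eqc_sym.
Qed.

(** If z = d b, each u_i - b is some d a_i, and w_i minus the difference of the a's is closed, hence
    x |-> x v_i; the differences telescope around the triangle, leaving y as the sum of the v_i.
    Conversely, subtracting x |-> x v_i from w_i makes the sum of the w_i vanish. *)
Lemma rel2_coboundary z y : rel2 z y ->
  is_coboundary act 2 z <-> exists v, (forall i, fixed_by (KE i) (v i)) /\ y = tsum v.
Proof.
case=> u [w [ui wi du duw wy]]; split=> [[b zb]|[v [fv yv]]].
- have ei i : eqc 2 (dcol 1 (fun s x => u i s x - b s)) (fun _ _ => 0).
    by apply: dcol_sub => s x sz Gs Gx; rewrite du // dcol_const -zb.
  have ii i : rinvc (KV i) 1 (fun s x => u i s x - b s) by apply: rinvcB.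
  have [a Ha] := functional_choice (fun i => dcol_exact (fKV i) (ii i) (ei i)).
  have di i : rinvc (KE i) 0 (fun s x => w i s x - (a i s x - a (nxt i) s x)).
    apply: rinvcB => //; apply: rinvcB.
      by apply: rinvc_sub (Ha i).1.
    by apply: rinvc_sub (Ha (nxt i)).1.
  have dd i : eqc 1 (dcol 0 (fun s x => w i s x - (a i s x - a (nxt i) s x))) (fun _ _ => 0).
    apply: dcol_sub => s x sz Gs Gx; rewrite dcolB -(duw i) // (Ha i).2 // (Ha (nxt i)).2 //.
    by rewrite opprB addrA subrK.
  have [v Hv] := functional_choice (fun i => dcol_exact0 (fKE i) (di i) (dd i)).
  exists v; split=> [i|]; first by case: (Hv i).
  rewrite -(act1 y) -(wy [::]) //= /tsum.
  rewrite -(act1 (v T0)) -(act1 (v T1)) -(act1 (v T2)).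
  rewrite -(Hv T0).2 // -(Hv T1).2 // -(Hv T2).2 //=.
  rewrite -[RHS]/(tsum (fun i => w i [::] 1 - (a i [::] 1 - a (nxt i) [::] 1))).
  by rewrite tsumB (tsum_nxt (fun i => a i [::] 1)) subr0.
- apply: (zigzag_coboundary (u := u) (w := fun i s x => w i s x - act x (v i))) => //.
  + by move=> i; apply: rinvcB => //; apply: rinvc_act.
  + by move=> i s x sz Gs Gx; rewrite dcolB dcol_act // subr0 duw.
  + move=> s x sz Gs Gx; rewrite tsumB wy // yv [X in X - _](_ : _ = tsum (fun i => act x (v i))) ?subrr //.
    by rewrite /tsum !linearD.
Qed.

Lemma rinvc_comb K j a c c' : rinvc K j c -> rinvc K j c' ->
  rinvc K j (fun s x => c s x + a *: c' s x).
Proof. by move=> ic ic' s sz Gs x k Gx kK; rewrite ic ?ic'. Qed.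

Lemma dcol_comb j a c c' s x :
  dcol j (fun s x => c s x + a *: c' s x) s x = dcol j c s x + a *: dcol j c' s x.
Proof. by rewrite dcolD (dcolZ j a c'). Qed.

Lemma sub_comb a (v w v' w' : V) : v + a *: v' - (w + a *: w') = v - w + a *: (v' - w').
Proof. by rewrite opprD addrACA scalerBr. Qed.

Lemma rel1_comb a z y z' y' : rel1 z y -> rel1 z' y' ->
  rel1 (fun s => z s + a *: z' s) (fun i => y i + a *: y' i).
Proof.
case=> u [ui du uy] [u' [ui' du' uy']]; exists (fun i s x => u i s x + a *: u' i s x).
split=> i; first exact: rinvc_comb.
- by move=> s x sz Gs Gx; rewrite dcol_comb du // du'.
- move=> s x sz Gs Gx; rewrite /= sub_comb [RHS]linearD /= linearZ /=.
  by have /= -> := uy i s x sz Gs Gx; have /= -> := uy' i s x sz Gs Gx.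
Qed.

Lemma rel2_comb a z y z' y' : rel2 z y -> rel2 z' y' ->
  rel2 (fun s => z s + a *: z' s) (y + a *: y').
Proof.
case=> u [w [ui wi du duw wy]] [u' [w' [ui' wi' du' duw' wy']]].
exists (fun i s x => u i s x + a *: u' i s x), (fun i s x => w i s x + a *: w' i s x).
split=> [i|i|i|i|].
- exact: rinvc_comb.
- exact: rinvc_comb.
- by move=> s x sz Gs Gx; rewrite dcol_comb du // du'.
- move=> s x sz Gs Gx; rewrite sub_comb dcol_comb.
  by have /= -> := duw i s x sz Gs Gx; have /= -> := duw' i s x sz Gs Gx.
- move=> s x sz Gs Gx; rewrite /= [RHS]linearD /= linearZ /= -(wy s x) // -(wy' s x) //.
  by rewrite tsum_comb.
Qed.

Lemma rel1_0 : rel1 (fun=> 0) (fun=> 0).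
Proof.
exists (fun _ _ _ => 0); split=> // i s x sz Gs Gx; last by rewrite subrr linear0.
exact: dcol0.
Qed.

Lemma rel2_0 : rel2 (fun=> 0) 0.
Proof.
exists (fun _ _ _ => 0), (fun _ _ _ => 0); split=> // [i|i|] s x sz Gs Gx.
- exact: dcol0.
- by rewrite subrr dcol0.
- by rewrite /tsum !addr0 linear0.
Qed.

End Triangle.
End Cochains.

(** * Symmetric powers *)

Section Matrix2.
Variable F : fieldType.

Definition mk2 (a b c d : F) : 'M[F]_2 :=
  \matrix_(i, j) if i == ord0 then (if j == ord0 then a else b)
                 else (if j == ord0 then c else d).

Lemma mk2_ord (P : 'I_2 -> Prop) : P ord0 -> P ord_max -> forall i, P i.
Proof.
move=> P0 P1 [[|[|//]] l].
  by rewrite (_ : Ordinal l = ord0) //; apply: val_inj.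
by rewrite (_ : Ordinal l = ord_max) //; apply: val_inj.
Qed.

Lemma mk2_eta (g : 'M[F]_2) : g = mk2 (g ord0 ord0) (g ord0 ord_max) (g ord_max ord0) (g ord_max ord_max).
Proof. by apply/matrixP => i j; move: i j; apply: mk2_ord; apply: mk2_ord; rewrite mxE. Qed.

Lemma mk2M a b c d a' b' c' d' : mk2 a b c d *m mk2 a' b' c' d' =
  mk2 (a * a' + b * c') (a * b' + b * d') (c * a' + d * c') (c * b' + d * d').
Proof.
apply/matrixP => i j; rewrite mxE !big_ord_recl big_ord0 addr0 !mxE /=.
by move: i j; apply: mk2_ord; apply: mk2_ord.
Qed.

Lemma mk2_1 : 1%:M = mk2 1 0 0 1.
Proof. by apply/matrixP => i j; move: i j; apply: mk2_ord; apply: mk2_ord; rewrite !mxE. Qed.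

Lemma mk2_inj a b c d a' b' c' d' : mk2 a b c d = mk2 a' b' c' d' ->
  [/\ a = a', b = b', c = c' & d = d'].
Proof.
move=> /matrixP E; move: (E ord0 ord0) (E ord0 ord_max) (E ord_max ord0) (E ord_max ord_max).
by rewrite !mxE.
Qed.

Lemma mk2_unit a b c d : a * d - b * c != 0 -> mk2 a b c d \is a GRing.unit.
Proof.
move=> D; set e := a * d - b * c in D.
by apply/unitrP; exists (mk2 (d / e) (- b / e) (- c / e) (a / e));
  split; rewrite -mulmxE mk2M -[RHS]/(1%:M) mk2_1;
  congr mk2; move: D; rewrite /e => D; field.
Qed.

Definition tr2 (g : 'M[F]_2) := g ord0 ord0 + g ord_max ord_max.
Definition det2 (g : 'M[F]_2) := g ord0 ord0 * g ord_max ord_max - g ord0 ord_max * g ord_max ord0.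

(* A non-scalar matrix has a cyclic vector v; the columns of h are v and g v. *)
Lemma conj_companion (g : 'M[F]_2) : ~ (exists a, g = a%:M) ->
  exists2 h, h \is a GRing.unit & g * h = h * mk2 0 (- det2 g) 1 (tr2 g).
Proof.
rewrite /det2 /tr2 (mk2_eta g) !mxE /=.
move: (g ord0 ord0) (g ord0 ord_max) (g ord_max ord0) (g ord_max ord_max) => a b c d ns.
have [c0|c0] := eqVneq c 0; last first.
  exists (mk2 1 a 0 c); first by apply: mk2_unit; rewrite mulr0 mul1r subr0.
  by rewrite -!mulmxE !mk2M; congr mk2; ring.
have [b0|b0] := eqVneq b 0; last first.
  exists (mk2 0 b 1 d); first by apply: mk2_unit; rewrite mulr1 mul0r sub0r oppr_eq0.
  by rewrite -!mulmxE !mk2M; congr mk2; ring.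
rewrite b0 c0 in ns *.
have [ad|ad] := eqVneq a d.
  case: ns; exists a; rewrite ad; apply/matrixP => i j.
  by move: i j; apply: mk2_ord; apply: mk2_ord; rewrite !mxE.
exists (mk2 1 a 1 d); first by apply: mk2_unit; rewrite mulr1 mul1r subr_eq0 eq_sym.
by rewrite -!mulmxE !mk2M; congr mk2; ring.
Qed.

End Matrix2.

(** * The action on S^n as matrices, and traces from trace and determinant *)

Section SymmetricPower.
Variable n : nat.

Definition linform (a b : Qi) : {poly Qi} := b%:P * 'X + a%:P.

Lemma linform_comb a b a' b' c d :
  c%:P * linform a b + d%:P * linform a' b' = linform (c * a + d * a') (c * b + d * b').
Proof. by rewrite /linform !polyCD !polyCM; ring. Qed.

Definition Smx (g : G) : 'M[Qi]_n.+1 :=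
  \matrix_(k, l) (linform (g ord0 ord0) (g ord_max ord0) ^+ (n - k)
                 * linform (g ord0 ord_max) (g ord_max ord_max) ^+ k)`_l.

Lemma symactE g v : symact g v = v *m Smx g.
Proof.
apply/rowP => l; rewrite !mxE coef_sum; apply: eq_bigr => k _.
by rewrite coefZ !mxE.
Qed.

(** [F] stands for the form of degree m with these coefficients in e1, e2; [P] and [Q] are
    substituted for e1 and e2. *)
Definition homogen (m : nat) (F P Q : {poly Qi}) := \sum_(l < m.+1) (F`_l)%:P * (P ^+ (m - l) * Q ^+ l).

Lemma homogen_linform m a b (F P Q : {poly Qi}) : (size F <= m.+1)%N ->
  homogen m.+1 (linform a b * F) P Q = (a%:P * P + b%:P * Q) * homogen m F P Q.
Proof.
move=> sF; have cE l : (linform a b * F)`_l = a * F`_l + b * (if l is l'.+1 then F`_l' else 0).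
  rewrite /linform mulrDl coefD coefCM -mulrA coefCM -['X * F]commr_polyX coefMX addrC.
  by case: l.
rewrite /homogen; under eq_bigr do rewrite cE polyCD mulrDl !polyCM.
rewrite big_split /= mulrDl !mulr_sumr; congr (_ + _).
- rewrite big_ord_recr /= nth_default // polyC0 mulr0 mul0r addr0.
  by apply: eq_bigr => l _; rewrite subSn ?leq_ord // exprS; ring.
- rewrite big_ord_recl /= polyC0 mulr0 mul0r add0r.
  by apply: eq_bigr => l _; rewrite /= subSS exprS; ring.
Qed.

Lemma size_linform a b : (size (linform a b) <= 2)%N.
Proof.
rewrite /linform (leq_trans (size_polyD _ _)) // geq_max (leq_trans (size_polyMleq _ _)) ?size_polyX.
  by rewrite (leq_trans (size_polyC_leq1 _)).
by rewrite addn2 /= ltnS size_polyC_leq1.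
Qed.

Lemma size_linform_mul a b (F : {poly Qi}) m : (size F <= m)%N -> (size (linform a b * F)%R <= m.+1)%N.
Proof.
move=> sF; rewrite (leq_trans (size_polyMleq _ _)) // -subn1 leq_subLR add1n.
by rewrite -addn2 addnC leq_add // size_linform.
Qed.

Lemma homogen_mono a b a' b' P Q i j :
  (size (linform a b ^+ i * linform a' b' ^+ j)%R <= (i + j).+1)%N /\
  homogen (i + j) (linform a b ^+ i * linform a' b' ^+ j) P Q =
  (a%:P * P + b%:P * Q) ^+ i * (a'%:P * P + b'%:P * Q) ^+ j.
Proof.
elim: i => [|i [s IH]].
  rewrite mul1r; elim: j => [|j [s IH]].
    by rewrite expr0 size_poly1 /homogen big_ord1 coefC eqxx !expr0 !mulr1.
  move: s IH; rewrite !add0n !mul1r !exprS => s IH; split; first exact: size_linform_mul.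
  by rewrite homogen_linform ?IH.
rewrite !exprS -!mulrA addSn; split; first exact: size_linform_mul.
by rewrite homogen_linform ?IH.
Qed.

(** Products are reversed because row vectors are multiplied from the right. The entries compare the
    substitution of the linear forms of g into the monomials obtained from h. *)
Lemma SmxM g h : Smx (g * h) = Smx h *m Smx g.
Proof.
apply/matrixP => k l; rewrite [LHS]mxE [RHS]mxE.
set P := linform (g ord0 ord0) (g ord_max ord0).
set Q := linform (g ord0 ord_max) (g ord_max ord_max).
have E j : linform ((g * h) ord0 j) ((g * h) ord_max j) = (h ord0 j)%:P * P + (h ord_max j)%:P * Q.
  rewrite linform_comb -mulmxE !mxE !big_ord_recl !big_ord0 !addr0.
  have -> : lift ord0 ord0 = ord_max :> 'I_2 by apply: val_inj.
  by congr linform; ring.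
have [_ H] := homogen_mono (h ord0 ord0) (h ord_max ord0) (h ord0 ord_max) (h ord_max ord_max) P Q (n - k) k.
rewrite !E -H subnK ?leq_ord // coef_sum; apply: eq_bigr => m _.
by rewrite coefCM !mxE.
Qed.

Lemma Smx1 : Smx 1 = 1%:M.
Proof.
apply/matrixP => k l; rewrite !mxE /= /linform !mul0r !add0r expr1n mul1r mul1r addr0.
by rewrite coefXn eq_sym.
Qed.

Lemma Smx_scale a g : Smx (a *: g) = a ^+ n *: Smx g.
Proof.
apply/matrixP => k l; rewrite !mxE.
have E c d : linform (a * c) (a * d) = a%:P * linform c d by rewrite /linform !polyCM; ring.
rewrite !E !exprMn mulrACA -exprD subnK ?leq_ord //.
by rewrite -rmorphXn /= coefCM.
Qed.

Lemma symact_linear g : linear (@symact n g).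
Proof. by move=> a u v; rewrite !symactE mulmxDl scalemxAl. Qed.

Lemma symact1 v : @symact n 1 v = v.
Proof. by rewrite symactE Smx1 mulmx1. Qed.

Lemma symactM g h v : @symact n (g * h) v = symact g (symact h v).
Proof. by rewrite !symactE SmxM mulmxA. Qed.

Definition tau (g : G) : Qi := \tr (Smx g).

Lemma tau_conj g h k : h \is a GRing.unit -> g * h = h * k -> tau g = tau k.
Proof.
move=> Uh gh; have -> : g = h * k / h by rewrite -gh mulrK.
rewrite /tau !SmxM mxtrace_mulC -mulmxA -SmxM mulVr // Smx1 mulmx1; by [].
Qed.

(** This evaluates traces without eigenvalues, which need not lie in Q(i), as for elements of order
    3. *)
Lemma tau_companion g : ~ (exists a, g = a%:M) -> tau g = tau (mk2 0 (- det2 g) 1 (tr2 g)).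
Proof. by move=> /conj_companion[h Uh gh]; apply: tau_conj gh. Qed.

(** Up to scalars the matrix exchanges e1^(n-k) e2^k with e1^k e2^(n-k), so only the middle monomial
    contributes. *)
Lemma tau_antidiag m d : n = m.*2 -> tau (mk2 0 (- d) 1 0) = (- d) ^+ m.
Proof.
move=> nm; rewrite /tau /mxtrace.
have E k : Smx (mk2 0 (- d) 1 0) k k = (- d) ^+ k * (k == n - k :> nat)%N%:R.
  rewrite !mxE /= /linform addr0 mul0r add0r mul1r -rmorphXn /= coefMC coefXn.
  by rewrite mulrC.
have lm : (m < n.+1)%N by rewrite ltnS nm -addnn leq_addr.
have nmm : (n - m)%N = m by rewrite nm -addnn addnK.
rewrite (bigD1 (Ordinal lm)) //= E /= nmm eqxx mulr1 big1 ?addr0 // => k nk.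
rewrite E (_ : (_ == _) = false) ?mulr0 //; apply/eqP => kk.
have ln := leq_ord k; case/eqP: nk; apply: val_inj => /=; apply: double_inj.
by have := subnK ln; rewrite -kk addnn => ->.
Qed.

Lemma tau_diag u : tau (mk2 1 0 0 u) = \sum_(k < n.+1) u ^+ k.
Proof.
apply: eq_bigr => k _; rewrite !mxE /= /linform !mul0r add0r addr0 expr1n mul1r exprMn.
by rewrite -rmorphXn /= coefCM coefXn eqxx mulr1.
Qed.

Lemma tau_scalar a : tau a%:M = a ^+ n * n.+1%:R.
Proof.
by rewrite -scalemx1 /tau Smx_scale -[1%:M]/(1 : G) Smx1 mxtraceZ mxtrace1.
Qed.

End SymmetricPower.

(** * Exactness by descent along a well-founded order *)

(** [Phi] takes a total function, while recursion supplies values at smaller arguments only; they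
    are extended by [b0], and the second hypothesis says that [Phi x] does not see the extension. *)
Lemma well_founded_recursion (A B : Type) (lt : A -> A -> Prop) (b0 : B) (Phi : A -> (A -> B) -> B) :
  well_founded lt ->
  (forall x g g', (forall y, lt y x -> g y = g' y) -> Phi x g = Phi x g') ->
  exists val, forall x, val x = Phi x val.
Proof.
move=> wf ext.
pose step x (rec : forall y, lt y x -> B) :=
  Phi x (fun y => match excluded_middle_informative (lt y x) with
                  | left p => rec y p | right _ => b0 end).
exists (Fix wf (fun _ => B) step) => x.
rewrite Fix_eq; last first.
  move=> y f g fg; apply: ext => z _.
  by case: excluded_middle_informative => // p; apply: fg.
by apply: ext => y yx; case: excluded_middle_informative.
Qed.

Lemma em_iff (P Q : Prop) (A : Type) (a b : A) : (P <-> Q) ->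
  (if excluded_middle_informative P then a else b) = if excluded_middle_informative Q then a else b.
Proof.
case=> pq qp; case: excluded_middle_informative => p; case: excluded_middle_informative => q //.
  by case: q; apply: pq.
by case: p; apply: qp.
Qed.

Lemma fin_subgroup_inv (K : seq G) k : fin_subgroup K -> k \in K -> k^-1 \in K.
Proof.
move=> fK kK; have := fin_subgroup1 fK.
rewrite -(perm_mem (fin_subgroup_perm fK kK)) => /mapP[k' k'K e].
have Uk := GL2Zi_unit (fin_subgroup_GL fK kK).
by rewrite (_ : k^-1 = k') //; apply: (mulrI Uk); rewrite mulrV.
Qed.

Lemma fin_subgroupM (K : seq G) k k' : fin_subgroup K -> k \in K -> k' \in K -> k * k' \in K.
Proof. by move=> fK kK k'K; rewrite -(perm_mem (fin_subgroup_perm fK kK)) map_f. Qed.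

Section DescentExactness.
Variable V : lmodType Qi.
Variables (KV KE : tri -> seq G) (KZ : seq G).
Hypothesis fKV : forall i, fin_subgroup (KV i).
Hypothesis fKE : forall i, fin_subgroup (KE i).
Hypothesis fKZ : fin_subgroup KZ.
Hypothesis sKEV : forall i, {subset KE i <= KV i}.
Hypothesis sKEV' : forall i, {subset KE i <= KV (nxt i)}.
Hypothesis sKZE : forall i, {subset KZ <= KE i}.

Variable lt : G -> G -> Prop.
Hypothesis lt_wf : well_founded lt.
Hypothesis lt_totalV : forall i x k, GL2Zi x -> k \in KV i -> k \notin KZ -> lt x (x * k) \/ lt (x * k) x.
Hypothesis lt_KZr : forall x y k, GL2Zi x -> k \in KZ -> lt y x <-> lt y (x * k).

(** An element x stands for a translate of the triangle, up to the scalars [KZ]; the products x k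
    with k in K are the translates sharing with it the face stabilised by K. *)
Definition minimal (K : seq G) (x : G) := forall k, k \in K -> ~ lt (x * k) x.

Hypothesis minimal_vertex : forall i x, GL2Zi x ->
  minimal (KE i) x -> minimal (KE (nxt (nxt i))) x -> minimal (KV i) x.
Hypothesis minimal_edge : forall x, GL2Zi x -> exists i, minimal (KE i) x.

Definition in_vertex (K : seq G) := exists i, {subset K <= KV i}.

Lemma in_vertexE i : in_vertex (KE i). Proof. by exists i. Qed.
Lemma in_vertexV i : in_vertex (KV i). Proof. by exists i. Qed.

(** A least element is unique only up to [KZ], but the choice depends on the coset alone, because
    [epsilon] is applied to a predicate that depends on the coset alone. *)
Definition least (K : seq G) (x : G) : G :=
  epsilon (inhabits (1 : G)) (fun y => (exists2 k, k \in K & y = x * k) /\ minimal K y).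

Section Coset.
Variable K : seq G.
Hypothesis fK : fin_subgroup K.
Hypothesis inK : in_vertex K.

Lemma coset_GL x k : GL2Zi x -> k \in K -> GL2Zi (x * k).
Proof. by move=> Gx kK; apply: GL2ZiM => //; apply: (fin_subgroup_GL fK). Qed.

Lemma minimal_ex x : exists y, (exists2 k, k \in K & y = x * k) /\ minimal K y.
Proof.
elim/(well_founded_ind lt_wf): x => x IH.
have [m|/not_all_ex_not[k nk]] := excluded_middle_informative (minimal K x).
  by exists x; split=> //; exists 1; rewrite ?mulr1 ?(fin_subgroup1 fK).
have [kK /NNPP ltk] := imply_to_and _ _ nk.
have [y [[k' k'K ->] my]] := IH _ ltk.
exists (x * k * k'); split=> //; exists (k * k'); rewrite ?mulrA //.
exact: fin_subgroupM.
Qed.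

Lemma least_coset x : exists2 k, k \in K & least K x = x * k.
Proof. by case: (epsilon_spec (inhabits (1 : G)) _ (minimal_ex x)). Qed.

Lemma least_minimal x : minimal K (least K x).
Proof. by case: (epsilon_spec (inhabits (1 : G)) _ (minimal_ex x)). Qed.

Lemma least_rinv x k : GL2Zi x -> k \in K -> least K (x * k) = least K x.
Proof.
move=> Gx kK; rewrite /least; congr epsilon; apply: functional_extensionality => y.
apply: propositional_extensionality; split=> -[[k' k'K ->] m]; split=> //.
  by exists (k * k'); rewrite ?mulrA //; apply: fin_subgroupM.
exists (k^-1 * k'); first by apply: fin_subgroupM => //; apply: fin_subgroup_inv.
by rewrite -!mulrA mulVKr // GL2Zi_unit //; apply: (fin_subgroup_GL fK).
Qed.

Lemma lt_total x k : GL2Zi x -> k \in K -> k \notin KZ -> lt x (x * k) \/ lt (x * k) x.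
Proof. by case: inK => i sK Gx kK kZ; apply: lt_totalV kZ => //; apply: sK. Qed.

Lemma least_of_minimal x : GL2Zi x -> minimal K x -> exists2 k, k \in KZ & least K x = x * k.
Proof.
move=> Gx m; have [k kK e] := least_coset x; exists k => //; apply: contraT => kZ.
case: (lt_total Gx kK kZ) => l; last by case: (m k kK).
have := @least_minimal x k^-1 (fin_subgroup_inv fK kK).
by rewrite e mulrK ?l // GL2Zi_unit //; apply: (fin_subgroup_GL fK).
Qed.

Lemma least_lt x : GL2Zi x -> ~ minimal K x -> lt (least K x) x.
Proof.
move=> Gx nm; have [k kK e] := least_coset x.
have Uk := GL2Zi_unit (fin_subgroup_GL fK kK).
have [kZ|kZ] := boolP (k \in KZ).
  case: nm => k' k'K l; apply: (@least_minimal x (k^-1 * k')).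
    by apply: fin_subgroupM => //; apply: fin_subgroup_inv.
  by rewrite e -!mulrA mulVKr // -lt_KZr.
case: (lt_total Gx kK kZ) => l; last by rewrite e.
have := @least_minimal x k^-1 (fin_subgroup_inv fK kK).
by rewrite e mulrK.
Qed.

Lemma minimal_KZ x z : {subset KZ <= K} -> GL2Zi x -> z \in KZ -> minimal K (x * z) <-> minimal K x.
Proof.
move=> sZ Gx zZ; have Gz := fin_subgroup_GL fKZ zZ; have Uz := GL2Zi_unit Gz.
split=> m k kK l.
  apply: (m (z^-1 * k)); first exact: fin_subgroupM (sZ _ (fin_subgroup_inv fKZ zZ)) kK.
  by rewrite -!mulrA mulVKr // -lt_KZr.
apply: (m (z * k)); first exact: fin_subgroupM (sZ _ zZ) kK.
by rewrite mulrA; apply/(lt_KZr _ Gx zZ).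
Qed.

End Coset.

Lemma sKZV i : {subset KZ <= KV i}.
Proof. by move=> k /(@sKZE i) /(@sKEV i). Qed.

(* The equation at x is solved by the value of F on an edge for which x is minimal: all other
   chambers on that edge come later. *)
Lemma descent_exact2 (f : G -> V) : rinv KZ f ->
  exists F : tri -> G -> V, (forall i, rinv (KE i) (F i)) /\
    forall x, GL2Zi x -> f x = tsum (F^~ x).
Proof.
move=> fZ.
pose e x := if excluded_middle_informative (minimal (KE T0) x) then T0 else
            if excluded_middle_informative (minimal (KE T1) x) then T1 else T2.
have eP x : GL2Zi x -> minimal (KE (e x)) x.
  move=> Gx; rewrite /e; do 2![case: excluded_middle_informative => // ?].
  by have [[]] := minimal_edge Gx.
have eZ x z : GL2Zi x -> z \in KZ -> e (x * z) = e x.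
  move=> Gx zZ; have m i := minimal_KZ (fKE i) (@sKZE i) Gx zZ.
  by rewrite /e (em_iff _ _ (m T0)) (em_iff _ _ (m T1)).
pose dec P (v : V) := if excluded_middle_informative P then v else 0.
have decT (P : Prop) v : P -> dec P v = v by rewrite /dec; case: excluded_middle_informative.
have decF (P : Prop) v : ~ P -> dec P v = 0 by rewrite /dec; case: excluded_middle_informative.
(* Each chamber spends its equation on the edge [e x]. Another edge j contributes a nonzero value at
   x only if its least chamber comes earlier and spent its own equation on j. *)
pose cond j x := [/\ lt (least (KE j) x) x, j <> e x & e (least (KE j) x) = j].
have [|val Hval] := @well_founded_recursion G V lt 0
  (fun x g => f x - tsum (fun j => dec (cond j x) (g (least (KE j) x)))) lt_wf.
  move=> x g g' gg'; congr (_ - _).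
  have E j : dec (cond j x) (g (least (KE j) x)) = dec (cond j x) (g' (least (KE j) x)).
    by rewrite /dec; case: excluded_middle_informative => // c; apply: gg'; case: c.
  by rewrite /tsum !E.
exists (fun i x => dec (e (least (KE i) x) = i) (val (least (KE i) x))); split=> [i x k Gx kK|x Gx].
  by rewrite least_rinv.
have [z zZ lz] := least_of_minimal (fKE (e x)) (in_vertexE (e x)) Gx (eP _ Gx).
have valx : val (least (KE (e x)) x) = val x.
  rewrite lz (Hval (x * z)) (Hval x) fZ //; congr (_ - _).
  have E j : dec (cond j (x * z)) (val (least (KE j) (x * z))) = dec (cond j x) (val (least (KE j) x)).
    rewrite least_rinv //; last exact: sKZE.
    apply: em_iff; rewrite /cond least_rinv //; last exact: sKZE.
    rewrite eZ //.
    by split=> -[l ? ?]; split=> //; apply/(lt_KZr _ Gx zZ).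
  by rewrite /tsum !E.
have Fe : dec (e (least (KE (e x)) x) = e x) (val (least (KE (e x)) x)) =
    f x - tsum (fun j => dec (cond j x) (val (least (KE j) x))).
  by rewrite decT ?valx // lz eZ.
have Fj j : j <> e x -> dec (e (least (KE j) x) = j) (val (least (KE j) x)) =
    dec (cond j x) (val (least (KE j) x)).
  move=> je; rewrite /dec; case: excluded_middle_informative => ej;
    case: excluded_middle_informative => c //; last by case: ej; case: c.
  have [m|nm] := excluded_middle_informative (minimal (KE j) x).
    have [z' z'Z lz'] := least_of_minimal (fKE j) (in_vertexE j) Gx m.
    by case: je; rewrite -[LHS]ej lz' eZ.
  by case: c; split=> //; apply: (least_lt (fKE j) (in_vertexE j)).
have ce : dec (cond (e x) x) (val (least (KE (e x)) x)) = 0 by apply: decF; case.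
move: Fe Fj ce; rewrite /tsum; case: (e x) => -> Fj ->.
- by rewrite !Fj // add0r -addrA subrK.
- by rewrite !Fj // addr0 [X in _ = X + _]addrC -addrA subrK.
- by rewrite !Fj // addr0 addrC subrK.
Qed.

Section Exact1.
Variable f : tri -> G -> V.
Hypothesis f_rinv : forall i, rinv (KE i) (f i).
Hypothesis f_sum : forall x, GL2Zi x -> tsum (f^~ x) = 0.

(** The values of f and the differences of F both sum to zero around the triangle, so two of the
    edge equations imply the third. *)
Lemma third_edge (F : tri -> V) i x : GL2Zi x ->
  (forall j, j <> i -> f j x = F j - F (nxt j)) -> f i x = F i - F (nxt i).
Proof.
move=> Gx H; pose d j := f j x - (F j - F (nxt j)).
have d0 : tsum d = 0 by rewrite (@tsumB V (f^~ x)) f_sum // tsum_nxt subrr.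
have dj j : j <> i -> d j = 0 by move=> /H fj; rewrite /d fj subrr.
apply/eqP; rewrite -subr_eq0 -/(d i); apply/eqP.
case: i dj {H} d0 => dj; rewrite /tsum.
- by rewrite (dj T1) // (dj T2) // !addr0.
- by rewrite (dj T0) // (dj T2) // addr0 add0r.
- by rewrite (dj T0) // (dj T1) // !add0r.
Qed.

(* F at a vertex is determined at the least chamber x containing it: if x is not a base chamber,
   the next vertex of x already lies on an earlier chamber. *)
Lemma descent_exact1 : exists F : tri -> G -> V, (forall i, rinv (KV i) (F i)) /\
  forall i x, GL2Zi x -> f i x = F i x - F (nxt i) x.
Proof.
pose dec (P : Prop) (v w : V) := if excluded_middle_informative P then v else w.
have decT (P : Prop) v w : P -> dec P v w = v by rewrite /dec; case: excluded_middle_informative.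
have decF (P : Prop) v w : ~ P -> dec P v w = w by rewrite /dec; case: excluded_middle_informative.
(* On a base chamber the edge equations are solved outright, normalised by the value 0 at the vertex
   [T0]. *)
pose b v x := match v with T0 => 0 | T1 => - f T0 x | T2 => f T2 x end.
pose base x := forall i, minimal (KE i) x.
have [|val Hval] := @well_founded_recursion G (tri -> V) lt (fun=> 0)
  (fun x g v => dec (base x) (b v x)
     (f v x + dec (lt (least (KV (nxt v)) x) x) (g (least (KV (nxt v)) x) (nxt v)) 0)) lt_wf.
  move=> x g g' gg'; apply: functional_extensionality => v; congr (dec _ _ (_ + _)).
  by rewrite /dec; case: excluded_middle_informative => // c; rewrite gg'.
pose F v x := val (least (KV v) x) v.
have Fi i : rinv (KV i) (F i) by move=> x k Gx kK; rewrite /F least_rinv.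
exists F; split=> // i x; elim/(well_founded_ind lt_wf): x i => x IH i Gx.
(* An edge already present in an earlier chamber was settled there, and its equation depends only on
   the edge. *)
have old j : ~ minimal (KE j) x -> f j x = F j x - F (nxt j) x.
  move=> nm; have l := least_lt (fKE j) (in_vertexE j) Gx nm.
  have [k kK e] := least_coset (fKE j) x.
  have := IH _ l j; rewrite e => /(_ (coset_GL (fKE j) Gx kK)).
  by rewrite f_rinv // (Fi j) ?sKEV // (Fi (nxt j)) ?sKEV'.
have mV j : minimal (KV j) x -> minimal (KE j) x.
  by move=> m k kK; apply: m; apply: sKEV.
(* Vertex j is new at x while the next vertex is old, so the recursive value at j is defined by
   exactly this equation. *)
have new j : minimal (KE j) x -> minimal (KE (nxt (nxt j))) x -> ~ minimal (KE (nxt j)) x ->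
    f j x = F j x - F (nxt j) x.
  move=> m1 m2 n; have mj := minimal_vertex Gx m1 m2.
  have [z zZ lz] := least_of_minimal (fKV j) (in_vertexV j) Gx mj.
  have l := least_lt (fKV (nxt j)) (in_vertexV (nxt j)) Gx (fun m => n (mV _ m)).
  rewrite [F j x]/F lz Hval decF; last first.
    by move=> H; apply: n; apply/(minimal_KZ (fKE _) (@sKZE _) Gx zZ).
  rewrite least_rinv //; last exact: sKZV.
  rewrite decT; last by rewrite -lt_KZr.
  by rewrite f_rinv ?addrK //; apply: sKZE.
have [m0|n0] := excluded_middle_informative (minimal (KE T0) x);
  have [m1|n1] := excluded_middle_informative (minimal (KE T1) x);
  have [m2|n2] := excluded_middle_informative (minimal (KE T2) x).
- have bx : base x by case.
  have FE v : F v x = b v x.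
    have mv : minimal (KV v) x by apply: minimal_vertex.
    have [z zZ lz] := least_of_minimal (fKV v) (in_vertexV v) Gx mv.
    rewrite /F lz Hval decT; last first.
      by move=> j; apply/(minimal_KZ (fKE _) (@sKZE _) Gx zZ).
    by case: v {lz mv} => //=; rewrite f_rinv //; apply: sKZE.
  have := f_sum Gx; rewrite /tsum !FE; case: i => /=.
  + by rewrite opprK add0r.
  + by move=> /eqP; rewrite addrAC addr_eq0 => /eqP e; rewrite -opprD e opprK.
  + by rewrite subr0.
all: pose solve := fun j => third_edge (F := F^~ x) (i := j) Gx.
- have e2 := old T2 n2; have e1 := new T1 m1 m0 n2.
  by case: i => //; apply: solve; case.
- have e1 := old T1 n1; have e0 := new T0 m0 m2 n1.
  by case: i => //; apply: solve; case.
- have e1 := old T1 n1; have e2 := old T2 n2.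
  by case: i => //; apply: solve; case.
- have e0 := old T0 n0; have e2 := new T2 m2 m1 n0.
  by case: i => //; apply: solve; case.
- have e0 := old T0 n0; have e2 := old T2 n2.
  by case: i => //; apply: solve; case.
- have e0 := old T0 n0; have e1 := old T1 n1.
  by case: i => //; apply: solve; case.
- by have [[]] := minimal_edge Gx.
Qed.

End Exact1.

Lemma descent_exact0 (F : G -> V) :
  (forall x, GL2Zi x -> (forall i, minimal (KE i) x) -> F x = F 1) ->
  (forall i, rinv (KV i) F) -> forall x, GL2Zi x -> F x = F 1.
Proof.
move=> Fbase Fi; elim/(well_founded_ind lt_wf) => x IH Gx.
have [m|/not_all_ex_not[i nm]] := excluded_middle_informative (forall i, minimal (KE i) x).
  exact: Fbase.
have l := least_lt (fKE i) (in_vertexE i) Gx nm.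
have [k kK e] := least_coset (fKE i) x.
rewrite -(Fi i x k) ?sKEV // -e; apply: IH => //.
by rewrite e; apply: (coset_GL (fKE i)).
Qed.

End DescentExactness.

(** * Stabilisers and displacements of the fundamental triangle *)

Lemma complexM (a b c d : rat) : Complex a b * Complex c d = Complex (a * c - b * d) (a * d + b * c).
Proof. by []. Qed.

Lemma complexD (a b c d : rat) : Complex a b + Complex c d = Complex (a + c) (b + d).
Proof. by []. Qed.

(** * Gaussian integers and matrices as integer tuples, and the finite stabilisers *)

Definition gi := (Z * Z)%type.
Definition gm := ((gi * gi) * (gi * gi))%type.

Definition giadd (x y : gi) : gi := (Z.add x.1 y.1, Z.add x.2 y.2).
Definition gimul (x y : gi) : gi := (Z.sub (Z.mul x.1 y.1) (Z.mul x.2 y.2), Z.add (Z.mul x.1 y.2) (Z.mul x.2 y.1)).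
Definition giconj (x : gi) : gi := (x.1, Z.opp x.2).
Definition gieqb (x y : gi) := Z.eqb x.1 y.1 && Z.eqb x.2 y.2.

Definition gmul (x y : gm) : gm :=
  ((giadd (gimul x.1.1 y.1.1) (gimul x.1.2 y.2.1), giadd (gimul x.1.1 y.1.2) (gimul x.1.2 y.2.2)),
   (giadd (gimul x.2.1 y.1.1) (gimul x.2.2 y.2.1), giadd (gimul x.2.1 y.1.2) (gimul x.2.2 y.2.2))).
Definition gadd (x y : gm) : gm :=
  ((giadd x.1.1 y.1.1, giadd x.1.2 y.1.2), (giadd x.2.1 y.2.1, giadd x.2.2 y.2.2)).
Definition gscale (u : gi) (x : gm) : gm :=
  ((gimul u x.1.1, gimul u x.1.2), (gimul u x.2.1, gimul u x.2.2)).
Definition gadj (x : gm) : gm :=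
  ((giconj x.1.1, giconj x.2.1), (giconj x.1.2, giconj x.2.2)).

Definition geqb (x y : gm) := [&& gieqb x.1.1 y.1.1, gieqb x.1.2 y.1.2,
  gieqb x.2.1 y.2.1 & gieqb x.2.2 y.2.2].

Definition zr (z : Z) : rat := (int_of_Z z)%:~R.

Lemma zrD x y : zr (Z.add x y) = zr x + zr y.
Proof. by rewrite /zr -intrD -rmorphD. Qed.
Lemma zrM x y : zr (Z.mul x y) = zr x * zr y.
Proof. by rewrite /zr -intrM -rmorphM. Qed.
Lemma zrN x : zr (Z.opp x) = - zr x.
Proof. by rewrite /zr -intrN -rmorphN. Qed.
Lemma zrB x y : zr (Z.sub x y) = zr x - zr y.
Proof. by rewrite -zrN -zrD. Qed.
Lemma zr_inj : injective zr.
Proof. by move=> x y /intr_inj /(can_inj int_of_ZK). Qed.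
Lemma zr_nat n : zr (Z.of_nat n) = n%:R.
Proof.
by rewrite /zr (_ : int_of_Z _ = n%:Z) //; lia.
Qed.

Definition toC (x : gi) : Qi := Complex (zr x.1) (zr x.2).
Definition toM (x : gm) : G := mk2 (toC x.1.1) (toC x.1.2) (toC x.2.1) (toC x.2.2).

Definition cj (x : Qi) : Qi := Complex (complex.Re x) (- complex.Im x).
Definition adj (x : G) : G :=
  mk2 (cj (x ord0 ord0)) (cj (x ord_max ord0)) (cj (x ord0 ord_max)) (cj (x ord_max ord_max)).

Lemma adj_mk2 a b c d : adj (mk2 a b c d) = mk2 (cj a) (cj c) (cj b) (cj d).
Proof. by rewrite /adj !mxE. Qed.

Lemma toC_add x y : toC (giadd x y) = toC x + toC y.
Proof. by rewrite /toC /= complexD !zrD. Qed.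
Lemma toC_mul x y : toC (gimul x y) = toC x * toC y.
Proof. by rewrite /toC /= complexM zrB zrD !zrM. Qed.
Lemma toC_conj x : toC (giconj x) = cj (toC x).
Proof. by rewrite /toC /cj /= zrN. Qed.
Lemma toC_nat n : toC (Z.of_nat n, Z0) = n%:R.
Proof. by rewrite Qi_natr /toC /= zr_nat. Qed.
Lemma toC_inj : injective toC.
Proof. by move=> [a b] [c d] [/zr_inj-> /zr_inj->]. Qed.

Lemma gieqbP x y : gieqb x y -> x = y.
Proof. by case: x y => [a b] [c d] /andP[/= /Z.eqb_eq-> /Z.eqb_eq->]. Qed.
Lemma geqbP x y : geqb x y -> x = y.
Proof.
by case: x y => [[? ?] [? ?]] [[? ?] [? ?]] /and4P[/= /gieqbP-> /gieqbP-> /gieqbP-> /gieqbP->].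
Qed.

Lemma cjM x y : cj (x * y) = cj x * cj y.
Proof. by case: x y => a b [c d]; rewrite /cj complexM /=; congr Complex; ring. Qed.
Lemma cjD x y : cj (x + y) = cj x + cj y.
Proof. by case: x y => a b [c d]; rewrite /cj complexD /=; congr Complex; ring. Qed.
Lemma cjK x : cj (cj x) = x.
Proof. by case: x => a b; rewrite /cj /= opprK. Qed.

Lemma mk2D (a b c d a' b' c' d' : Qi) :
  mk2 a b c d + mk2 a' b' c' d' = mk2 (a + a') (b + b') (c + c') (d + d').
Proof. by apply/matrixP => i j; move: i j; apply: mk2_ord; apply: mk2_ord; rewrite !mxE. Qed.

Lemma mk2Z (u a b c d : Qi) : u *: mk2 a b c d = mk2 (u * a) (u * b) (u * c) (u * d).
Proof. by apply/matrixP => i j; move: i j; apply: mk2_ord; apply: mk2_ord; rewrite !mxE. Qed.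

Lemma toM_mul x y : toM (gmul x y) = toM x * toM y.
Proof. by rewrite -mulmxE mk2M /toM /= !toC_add !toC_mul. Qed.
Lemma toM_add x y : toM (gadd x y) = toM x + toM y.
Proof. by rewrite mk2D /toM /= !toC_add. Qed.
Lemma toM_scale u x : toM (gscale u x) = toC u *: toM x.
Proof. by rewrite mk2Z /toM /= !toC_mul. Qed.
Lemma toM_adj x : toM (gadj x) = adj (toM x).
Proof. by rewrite /adj /toM !mxE /= !toC_conj. Qed.
Lemma toM_inj : injective toM.
Proof.
by move=> [[a b] [c d]] [[a' b'] [c' d']] /mk2_inj[/toC_inj/= -> /toC_inj/= -> /toC_inj/= -> /toC_inj/= ->].
Qed.

Lemma adjM x y : adj (x * y) = adj y * adj x.
Proof.
rewrite (mk2_eta x) (mk2_eta y) -!mulmxE mk2M /adj !mxE /= mk2M !cjD !cjM.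
by congr mk2; rewrite ![cj (x _ _) * _]mulrC.
Qed.
Lemma adjB x y : adj (x - y) = adj x - adj y.
Proof.
have cjB u v : cj (u - v) = cj u - cj v.
  by case: u v => a b [c d]; congr Complex; rewrite /= opprD opprK.
by apply/matrixP => i j; move: i j; apply: mk2_ord; apply: mk2_ord; rewrite !mxE /= cjB.
Qed.
Lemma adjK x : adj (adj x) = x.
Proof. by rewrite [RHS]mk2_eta /adj !mxE /= !cjK. Qed.

Definition gi0 : gi := (Z0, Z0).
Definition gi1 : gi := (Zpos xH, Z0).
Definition gii : gi := (Z0, Zpos xH).
Definition giN1 : gi := (Zneg xH, Z0).
Definition gunits : seq gi := [:: gi1; gii; giN1; (Z0, Zneg xH)].
Definition gdiag (u v : gi) : gm := ((u, gi0), (gi0, v)).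
Definition gone : gm := gdiag gi1 gi1.

Lemma toM_one : toM gone = 1.
Proof. by rewrite -[RHS]/(1%:M) mk2_1. Qed.

(* Membership up to a unit scalar. *)
Definition gin (x : gm) (R : seq gm) := has (fun u => has (geqb (gscale u x)) R) gunits.

Definition gen_step (gs s : seq gm) :=
  foldl (fun acc x => if gin x acc then acc else rcons acc x) s [seq gmul x g | x <- s, g <- gs].
(** Six rounds of multiplication by the generators exhaust each of the groups below; closure of the
    resulting lists is tested by [gcheck_group]. *)
Definition gen (gs : seq gm) := iter 6 (gen_step gs) [:: gone].

(* As Moebius transformations: 1/(1-z), 1/z, i/z, 1+iz, 1-z and iz. *)
Definition g_rho : gm := ((gi0, gi1), (giN1, gi1)).
Definition g_sigma : gm := ((gi0, gi1), (gi1, gi0)).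
Definition g_theta : gm := ((gi0, gii), (gi1, gi0)).
Definition g_delta : gm := ((gii, gi1), (gi0, gi1)).
Definition g_eps : gm := ((giN1, gi1), (gi0, gi1)).
Definition g_iota : gm := gdiag gii gi1.

(* Representatives modulo the centre of the stabilisers of the vertices and edges of
   a triangle in hyperbolic space: S4, S3, D4 and C3, C2, C2. *)
Definition gRV i : seq gm := Eval vm_compute in match i with
  | T0 => gen [:: g_rho; g_theta; g_delta]
  | T1 => gen [:: g_sigma; g_eps]
  | T2 => gen [:: g_sigma; g_iota] end.
Definition gRE i : seq gm := Eval vm_compute in match i with
  | T0 => gen [:: g_rho] | T1 => gen [:: g_sigma] | T2 => gen [:: g_theta] end.

Definition gK (R : seq gm) : seq gm := [seq gscale u r | u <- gunits, r <- R].
Definition KV i := map toM (gK (gRV i)).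
Definition KE i := map toM (gK (gRE i)).
Definition KZ := map toM (gK [:: gone]).

Lemma gunitsV : all (fun u => has (fun v => gieqb (gimul v u) gi1) gunits) gunits.
Proof. by []. Qed.
Lemma gunitsM : all (fun u => all (fun v => gimul u v \in gunits) gunits) gunits.
Proof. by []. Qed.

Lemma gauss_int_toC x : gauss_int (toC x).
Proof. by split; rewrite /= intr_int. Qed.

Lemma gauss_int_mx_mk2 a b c d : gauss_int a -> gauss_int b -> gauss_int c -> gauss_int d ->
  gauss_int_mx (mk2 a b c d).
Proof. by move=> ? ? ? ? i j; move: i j; apply: mk2_ord; apply: mk2_ord; rewrite mxE. Qed.

Lemma gauss_int_mx_toM x : gauss_int_mx (toM x).
Proof. by apply: gauss_int_mx_mk2; apply: gauss_int_toC. Qed.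

Lemma KP R k : reflect (exists u r, [/\ u \in gunits, r \in R & k = toC u *: toM r])
                       (k \in map toM (gK R)).
Proof.
apply: (iffP mapP) => [[x /allpairsP[[u r] /= [ug rR ->]] ->]|[u [r [ug rR ->]]]].
  by exists u, r; rewrite toM_scale.
by exists (gscale u r); [apply: allpairs_f|rewrite toM_scale].
Qed.

Lemma ginP x R : gin x R -> toM x \in map toM (gK R).
Proof.
case/hasP=> u ug /hasP[r rR /geqbP e]; apply/KP.
have [v vg /gieqbP vu] := hasP (allP gunitsV u ug).
by exists v, r; split=> //; rewrite -e toM_scale scalerA -toC_mul vu scale1r.
Qed.

Lemma K_scale u k R : u \in gunits -> k \in map toM (gK R) -> toC u *: k \in map toM (gK R).
Proof.
move=> ug /KP[v [r [vg rR ->]]]; apply/KP; exists (gimul u v), r; split=> //.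
  exact: (allP (allP gunitsM u ug)).
by rewrite scalerA toC_mul.
Qed.

Definition gcheck_group (R : seq gm) :=
  [&& uniq (gK R), gin gone R, all (fun r => all (fun r' => gin (gmul r r') R) R) R &
      all (fun r => has (fun r' => gin (gmul r r') [:: gone] && gin (gmul r' r) [:: gone]) R) R].

(** The tests hold up to unit scalars, and [gK] adjoins all of these. Left translation then maps a
    duplicate-free list injectively into itself, hence permutes it. *)
Lemma gcheck_groupP R : gcheck_group R -> fin_subgroup (map toM (gK R)).
Proof.
case/and4P=> uR R1 /allP RR /allP RV.
have KM k k' : k \in map toM (gK R) -> k' \in map toM (gK R) -> k * k' \in map toM (gK R).
  move=> /KP[u [r [ug rR ->]]] /KP[u' [r' [ug' rR' ->]]].
  rewrite -scalerAl -scalerAr -toM_mul; do 2!apply: K_scale => //.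
  by apply: ginP; apply: (allP (RR r rR)).
have KG k : k \in map toM (gK R) -> GL2Zi k.
  case/KP=> u [r [ug rR ->]].
  have [v vg /gieqbP vu] := hasP (allP gunitsV u ug).
  have [r' r'R /andP[/ginP/KP[w [? [wg + e]]] /ginP/KP[w' [? [w'g + e']]]]] := hasP (RV r rR).
  rewrite !inE => /eqP E' /eqP E; move: e e'; rewrite E E' toM_one !toM_mul => e e'.
  have [x _ /gieqbP xw] := hasP (allP gunitsV w wg).
  have [x' _ /gieqbP xw'] := hasP (allP gunitsV w' w'g).
  have k1 : toC u *: toM r * (toC (gimul v x) *: toM r') = 1.
    rewrite -scalerAl -scalerAr e !scalerA !toC_mul.
    rewrite [X in X *: _](_ : _ = toC v * toC u * (toC x * toC w)); last by ring.
    by rewrite -!toC_mul vu xw scale1r.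
  have k2 : (toC (gimul v x') *: toM r') * (toC u *: toM r) = 1.
    rewrite -scalerAl -scalerAr e' !scalerA !toC_mul.
    rewrite [X in X *: _](_ : _ = toC v * toC u * (toC x' * toC w')); last by ring.
    by rewrite -!toC_mul vu xw' scale1r.
  have E3 : toC (gimul v x) *: toM r' = toC (gimul v x') *: toM r'.
    by rewrite -[LHS]mul1r -k2 -mulrA k1 mulr1.
  split; first by rewrite -toM_scale; apply: gauss_int_mx_toM.
  exists (toC (gimul v x) *: toM r'); split; first by rewrite -toM_scale; apply: gauss_int_mx_toM.
  by split; [exact: k1|rewrite E3; exact: k2].
split=> //; first by rewrite -toM_one; apply: ginP.
move=> k kK.
have uK : uniq (map toM (gK R)) by rewrite map_inj_uniq //; apply: toM_inj.
have uk : uniq [seq k * k' | k' <- map toM (gK R)].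
  by rewrite map_inj_uniq //; apply: mulrI; apply: GL2Zi_unit; apply: KG.
have sk : {subset [seq k * k' | k' <- map toM (gK R)] <= map toM (gK R)}.
  by move=> _ /mapP[k' k'K ->]; apply: KM.
apply: uniq_perm => //.
by have [|_ e] := uniq_min_size uk sk; rewrite ?size_map.
Qed.

Lemma fin_KV i : fin_subgroup (KV i).
Proof. by apply: gcheck_groupP; case: i; vm_compute. Qed.
Lemma fin_KE i : fin_subgroup (KE i).
Proof. by apply: gcheck_groupP; case: i; vm_compute. Qed.
Lemma fin_KZ : fin_subgroup KZ.
Proof. by apply: gcheck_groupP; vm_compute. Qed.

Lemma map_toM_sub (R R' : seq gm) : all (fun r => gin r R') R ->
  {subset map toM (gK R) <= map toM (gK R')}.
Proof. by move=> /allP s _ /KP[u [r [ug rR ->]]]; apply: K_scale => //; apply: ginP; apply: s. Qed.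

Lemma sub_KEV i : {subset KE i <= KV i}.
Proof. by apply: map_toM_sub; case: i; vm_compute. Qed.
Lemma sub_KEV' i : {subset KE i <= KV (nxt i)}.
Proof. by apply: map_toM_sub; case: i; vm_compute. Qed.
Lemma sub_KZE i : {subset KZ <= KE i}.
Proof. by apply: map_toM_sub; case: i; vm_compute. Qed.

(** * Hermitian forms, displacements and the order on chambers *)

Definition herm (a c b1 b2 : Z) : gm := (((a, Z0), (b1, b2)), ((b1, Z.opp b2), (c, Z0))).

(* The point on the unit hemisphere above (2+i)/6, inside the triangle. *)
Definition gX : gm := herm 6 6 2 1.
(* Displacements of gX by the reflections in the sides of the triangle: beta1 and
   beta1' by the one in Re z = 1/2 and its conjugate under z -> 1/conj(z), beta2 by the
   one in Re z = Im z, beta3 by the one in Im z = 0. *)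
Definition gbeta1 : gm := herm 2 0 2 0.
Definition gbeta1' : gm := herm 0 2 2 0.
Definition gbeta2 : gm := herm 0 0 (-1) 1.
Definition gbeta3 : gm := herm 0 0 0 (-2).

Definition gconj (k b : gm) := gmul (gmul k b) (gadj k).

Definition lex4 (a b c d : rat) : Prop :=
  0 < a \/ (a = 0 /\ (0 < b \/ (b = 0 /\ (0 < c \/ (c = 0 /\ 0 < d))))).

Lemma lex4D a b c d a' b' c' d' : lex4 a b c d -> lex4 a' b' c' d' ->
  lex4 (a + a') (b + b') (c + c') (d + d').
Proof.
rewrite /lex4; case=> [?|[-> [?|[-> [?|[-> ?]]]]]] [?|[-> [?|[-> [?|[-> ?]]]]]];
  rewrite ?addr0 ?add0r;
  do ?[by left; lra | by right; split=> //; left; lra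
    | right; split=> //; right; split=> //].
all: try by left; lra.
all: by right; split=> //; lra.
Qed.

Lemma lex4_total a b c d : lex4 a b c d \/ lex4 (- a) (- b) (- c) (- d) \/
  [/\ a = 0, b = 0, c = 0 & d = 0].
Proof.
rewrite /lex4 !oppr_gt0.
case: (ltrgtP a 0) => [?|?|->]; [by right; left; left|by left; left|].
case: (ltrgtP b 0) => [?|?|->]; [by right; left; right; rewrite oppr0; split=> //; left
  |by left; right; split=> //; left|].
case: (ltrgtP c 0) => [?|?|->].
- by right; left; right; rewrite !oppr0; split=> //; right; split=> //; left.
- by left; right; split=> //; right; split=> //; left.
case: (ltrgtP d 0) => [?|?|->]; last by right; right.
- by right; left; right; rewrite !oppr0; split=> //; right; split=> //; right.
- by left; right; split=> //; right; split=> //; right.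
Qed.

Definition lexpos (M : G) := lex4 (complex.Re (M ord0 ord0)) (complex.Re (M ord_max ord_max))
  (complex.Re (M ord0 ord_max)) (complex.Im (M ord0 ord_max)).

Lemma ReD (x y : Qi) : complex.Re (x + y) = complex.Re x + complex.Re y.
Proof. by case: x y => a b []. Qed.
Lemma ImD (x y : Qi) : complex.Im (x + y) = complex.Im x + complex.Im y.
Proof. by case: x y => a b []. Qed.
Lemma ReN (x : Qi) : complex.Re (- x) = - complex.Re x. Proof. by case: x. Qed.
Lemma ImN (x : Qi) : complex.Im (- x) = - complex.Im x. Proof. by case: x. Qed.

Lemma lexposD M N : lexpos M -> lexpos N -> lexpos (M + N).
Proof. by rewrite /lexpos !mxE !ReD ImD; apply: lex4D. Qed.

Lemma lexpos0 : ~ lexpos 0.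
Proof. by rewrite /lexpos /lex4 !mxE /= ltxx => -[|[_ [|[_ [|[]]]]]]. Qed.

Lemma lexpos_total M : adj M = M -> lexpos M \/ lexpos (- M) \/ M = 0.
Proof.
rewrite (mk2_eta M) /adj !mxE /=.
move: (M ord0 ord0) (M ord0 ord_max) (M ord_max ord0) (M ord_max ord_max).
move=> [a a'] [b b'] [c c'] [d d'] /mk2_inj[/= [ea] [<- <-] _ [ed]].
rewrite /lexpos !mxE /=.
have [|[|[-> -> -> c0]]] := lex4_total a d c (- c'); [by left|by right; left|right; right].
move/eqP: c0; rewrite oppr_eq0 => /eqP->.
have -> : a' = 0 by lra.
have -> : d' = 0 by lra.
by rewrite oppr0; apply/matrixP => i j; move: i j; apply: mk2_ord; apply: mk2_ord; rewrite !mxE.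
Qed.

(* The displacement M moves the chamber x away from the base chamber. *)
Definition pos (x M : G) := lexpos (x * M * adj x).

Lemma posD x M N : pos x M -> pos x N -> pos x (M + N).
Proof. by rewrite /pos mulrDr mulrDl; apply: lexposD. Qed.

Lemma adj_unit x : x \is a GRing.unit -> adj x \is a GRing.unit.
Proof.
move=> Ux; have a1 : adj 1 = 1 by rewrite -toM_one -toM_adj.
by apply/unitrP; exists (adj x^-1); rewrite -!adjM mulrV // mulVr.
Qed.

Lemma pos_total x M : x \is a GRing.unit -> adj M = M -> M <> 0 -> pos x M \/ pos x (- M).
Proof.
move=> Ux hM M0; have hxM : adj (x * M * adj x) = x * M * adj x.
  by rewrite !adjM adjK hM mulrA.
case: (lexpos_total hxM) => [|[|z]]; [by left|by right; rewrite /pos mulrN mulNr|].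
case: M0; apply: (mulrI Ux); apply: (mulIr (adj_unit Ux)).
by rewrite z mulr0 mul0r.
Qed.

Lemma pos_mulrSn x M n : pos x M -> pos x (M *+ n.+1).
Proof. by move=> p; elim: n => [|n IH]; [exact: p|rewrite mulrS; apply: posD]. Qed.

Lemma pos_comb x M1 M2 M3 n1 n2 n3 : pos x M1 -> pos x M2 -> pos x M3 ->
  let M := M1 *+ n1 + M2 *+ n2 + M3 *+ n3 in M = 0 \/ pos x M.
Proof.
move=> p1 p2 p3 /=.
have c M n : pos x M -> M *+ n = 0 \/ pos x (M *+ n).
  by case: n => [|n] p; [left; rewrite mulr0n|right; apply: pos_mulrSn].
have s M N : M = 0 \/ pos x M -> N = 0 \/ pos x N -> M + N = 0 \/ pos x (M + N).
  case=> [->|p]; first by rewrite add0r.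
  case=> [->|q]; first by rewrite addr0; right.
  by right; apply: posD.
by apply: (s _ _ (s _ _ (c _ _ p1) (c _ _ p2)) (c _ _ p3)).
Qed.

Definition Hform (x : G) : G := x * toM gX * adj x.

(* Lexicographic order on the entries of the form: the height seen from a point infinitely close
   to the cusp, perturbed so that there are no ties. *)
Definition chamber_lt (x y : G) := [/\ GL2Zi x, GL2Zi y & lexpos (Hform y - Hform x)].

Lemma Hform_mul x k : Hform (x * k) = x * (k * toM gX * adj k) * adj x.
Proof. by rewrite /Hform adjM !mulrA. Qed.

Lemma gauss_int_adj x : gauss_int_mx x -> gauss_int_mx (adj x).
Proof.
move=> xi; have cji i j : gauss_int (cj (x i j)).
  by case: (xi i j) => Re_int Im_int; split; rewrite //= rpredN.
exact: gauss_int_mx_mk2.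
Qed.

(* The values of the positive definite form gX at the rows of x and their sums bound
   the entries of Hform x. *)
Lemma Hform_ge0 x : let M := Hform x in
  [/\ 0 <= complex.Re (M ord0 ord0), 0 <= complex.Re (M ord_max ord_max),
      0 <= complex.Re (M ord0 ord0) + complex.Re (M ord_max ord_max) + 2 * complex.Re (M ord0 ord_max) &
      0 <= complex.Re (M ord0 ord0) + complex.Re (M ord_max ord_max) + 2 * complex.Im (M ord0 ord_max)].
Proof.
have zr6 : zr 6 = 6 by rewrite /zr.
have zr2 : zr 2 = 2 by rewrite /zr.
have zr1 : zr 1 = 1 by rewrite /zr.
have zrm1 : zr (Z.opp 1) = -1 by rewrite /zr.
have zr0 : zr Z0 = 0 by rewrite /zr.
rewrite /Hform (mk2_eta x) /toM /gX /herm /toC /= zr6 zr2 zr1 zrm1 zr0.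
move: (x ord0 ord0) (x ord0 ord_max) (x ord_max ord0) (x ord_max ord_max).
move=> [p p'] [q q'] [r r'] [s s'].
rewrite adj_mk2 -!mulmxE !mk2M !mxE /=.
have form (a a' b b' : rat) : 0 <= 6 * (a ^+ 2 + a' ^+ 2) + 6 * (b ^+ 2 + b' ^+ 2)
    + 4 * (a * b + a' * b') - 2 * (a' * b - a * b').
  have := sqr_ge0 (a + b); have := sqr_ge0 (a' + b'); have := sqr_ge0 (a + b').
  have := sqr_ge0 (a' - b); have := sqr_ge0 a; have := sqr_ge0 a'.
  have := sqr_ge0 b; have := sqr_ge0 b'; lra.
split.
- by apply: le_trans (form p p' q q') _; rewrite le_eqVlt; apply/orP; left; apply/eqP; ring.
- by apply: le_trans (form r r' s s') _; rewrite le_eqVlt; apply/orP; left; apply/eqP; ring.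
- by apply: le_trans (form (p + r) (p' + r') (q + s) (q' + s')) _; rewrite le_eqVlt; apply/orP; left; apply/eqP; ring.
- by apply: le_trans (form (p - r') (p' + r) (q - s') (q' + s)) _; rewrite le_eqVlt; apply/orP; left; apply/eqP; ring.
Qed.

Definition lexnat := slexprod _ _ lt (slexprod _ _ lt (slexprod _ _ lt lt)).

Lemma lexnat_wf : well_founded lexnat.
Proof. by do 3![apply: wf_slexprod; first exact: Wf_nat.lt_wf]; exact: Wf_nat.lt_wf. Qed.

(** Off-diagonal entries may be negative. Twice their real and imaginary parts become natural
    numbers after adding a + c, and this shift is harmless because they are compared only when a and
    c agree. *)
Definition chamber_key (x : G) : nat * (nat * (nat * nat)) :=
  let M := Hform x in
  let a := complex.Re (M ord0 ord0) in let c := complex.Re (M ord_max ord_max) in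
  (Num.truncn a, (Num.truncn c, (Num.truncn (a + c + 2 * complex.Re (M ord0 ord_max)),
    Num.truncn (a + c + 2 * complex.Im (M ord0 ord_max))))).

Lemma chamber_lt_key x y : chamber_lt x y -> lexnat (chamber_key x) (chamber_key y).
Proof.
have key z : GL2Zi z -> let M := Hform z in
    let a := complex.Re (M ord0 ord0) in let c := complex.Re (M ord_max ord_max) in
    let d := a + c + 2 * complex.Re (M ord0 ord_max) in
    let e := a + c + 2 * complex.Im (M ord0 ord_max) in
    exists n1 n2 n3 n4 : nat, [/\ [/\ a = n1%:R, c = n2%:R, d = n3%:R & e = n4%:R] &
      chamber_key z = (n1, (n2, (n3, n4)))].
  case=> zi _ /=; have [h1 h2 h3 h4] := Hform_ge0 z.
  have Mi : gauss_int_mx (Hform z).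
    by apply: gauss_int_mxM; [apply: gauss_int_mxM => //; apply: gauss_int_mx_toM|apply: gauss_int_adj].
  have nat_of (a : rat) : a \is a Num.int -> 0 <= a -> a = (Num.truncn a)%:R.
    by move=> ai a0; apply/esym/truncnK; rewrite natrEint ai.
  have [i00 _] := Mi ord0 ord0; have [i11 _] := Mi ord_max ord_max; have [r01 m01] := Mi ord0 ord_max.
  by do 4!eexists; split; last reflexivity; split; apply: nat_of; rewrite // ?rpredD ?rpredM.
case=> Gx Gy.
have [a [c [d [e [[Ea Ec Ed Ee] ->]]]]] := key x Gx.
have [a' [c' [d' [e' [[Ea' Ec' Ed' Ee'] ->]]]]] := key y Gy.
move: Ea Ec Ed Ee Ea' Ec' Ed' Ee'; move: (Hform x) (Hform y) => M N.
rewrite /lexpos !mxE !ReD ImD !ReN ImN.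
have ltn (m n : nat) : (m%:R < n%:R :> rat) -> (m < n)%coq_nat by rewrite ltr_nat => /ssrnat.ltP.
have eqn (m n : nat) : (m%:R = n%:R :> rat) -> m = n by move/eqP; rewrite eqr_nat => /eqP.
move=> Ea Ec Ed Ee Ea' Ec' Ed' Ee'; case=> [l|[e1 H]].
  by apply: left_slex; apply: ltn; lra.
rewrite (eqn a a'); last by lra.
apply: right_slex; case: H => [l|[e2 H]].
  by apply: left_slex; apply: ltn; lra.
rewrite (eqn c c'); last by lra.
apply: right_slex; case: H => [l|[e3 l]].
  by apply: left_slex; apply: ltn; lra.
rewrite (eqn d d'); last by lra.
by apply: right_slex; apply: ltn; lra.
Qed.

Lemma chamber_lt_wf : well_founded chamber_lt.
Proof.
apply: (wf_incl _ _ _ chamber_lt_key); exact: wf_inverse_image lexnat_wf.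
Qed.

(** [coef] reads the root coefficients off the entries of the displaced point; comparing with the
    whole displacement, as [gcheck_disp] does, confirms the guess and its nonnegativity. *)
Definition gdisp (coef : gm -> nat * nat * nat) (b1 b2 b3 : gm) (r : gm) :=
  let: (n1, n2, n3) := coef (gconj r gX) in
  gadd (gadd (gscale (Z.of_nat n1, Z0) b1) (gscale (Z.of_nat n2, Z0) b2))
       (gscale (Z.of_nat n3, Z0) b3).

Definition gcheck_disp coef b1 b2 b3 (R : seq gm) :=
  all (fun r => geqb (gconj r gX) (gadd gX (gdisp coef b1 b2 b3 r))) R.

Lemma adj_scale u M : adj (u *: M) = cj u *: adj M.
Proof. by rewrite (mk2_eta M) mk2Z !adj_mk2 mk2Z !cjM. Qed.

Lemma gunit_norm u : u \in gunits -> toC u * cj (toC u) = 1.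
Proof.
move=> ug; have : all (fun u => gieqb (gimul u (giconj u)) gi1) gunits by [].
by move=> /allP /(_ u ug) /gieqbP; rewrite -toC_conj -toC_mul => ->.
Qed.

Lemma Hform_K R x k : k \in map toM (gK R) -> exists r,
  [/\ r \in R, gin r [:: gone] -> k \in KZ &
    Hform (x * k) - Hform x = x * (toM (gconj r gX) - toM gX) * adj x].
Proof.
case/KP=> u [r [ug rR ek]]; exists r; split=> //.
  by move=> /ginP rZ; rewrite ek; exact: (K_scale ug rZ).
have e : k * toM gX * adj k = toM (gconj r gX).
  rewrite /gconj !toM_mul toM_adj ek; move: (toM r) (toM gX) => M X.
  by rewrite adj_scale -!scalerAl -scalerAr scalerA gunit_norm // scale1r.
rewrite Hform_mul e /Hform; move: (toM (gconj r gX)) (toM gX) => M X.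
by rewrite mulrBr mulrBl.
Qed.

Lemma Hform_KZ x k : k \in KZ -> Hform (x * k) = Hform x.
Proof.
case/(Hform_K x) => r []; rewrite inE => /eqP-> _.
have -> : gconj gone gX = gX by [].
move: (toM gX) => X; rewrite subrr mulr0 mul0r; exact: subr0_eq.
Qed.

(** The positive displacements form a cone: every displacement by the group is zero or positive at x
    as soon as the three generators are positive, and neither case gives a descent. *)
Lemma disp_minimal coef b1 b2 b3 R x : gcheck_disp coef b1 b2 b3 R ->
  pos x (toM b1) -> pos x (toM b2) -> pos x (toM b3) ->
  minimal chamber_lt (map toM (gK R)) x.
Proof.
move=> /allP chk p1 p2 p3 k kK [_ _].
have [r [rR _ e]] := Hform_K x kK; rewrite -opprB e.
rewrite (geqbP (chk r rR)) toM_add addrC addKr /gdisp.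
case: (coef _) => -[n1 n2] n3; rewrite !toM_add !toM_scale !toC_nat !scaler_nat.
case: (pos_comb n1 n2 n3 p1 p2 p3) => [->|p].
  by rewrite mulr0 mul0r oppr0 => /lexpos0.
by move=> /(lexposD p); rewrite subrr => /lexpos0.
Qed.

Definition zhalf (z : Z) := Z.to_nat (Z.div2 z).
Definition coef_ac (m : gm) := (zhalf (Z.sub m.1.1.1 6), zhalf (Z.sub m.2.2.1 6)).

Lemma check_disp_V0 : gcheck_disp (fun m => (coef_ac m, Z.to_nat (Z.sub m.1.2.2 1)))
  gbeta1 gbeta1' gbeta2 (gRV T0).
Proof. by vm_compute. Qed.
Lemma check_disp_V1 : gcheck_disp (fun m => (coef_ac m, zhalf (Z.sub 1 m.1.2.2)))
  gbeta1 gbeta1' gbeta3 (gRV T1).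
Proof. by vm_compute. Qed.
Lemma check_disp_V2 : gcheck_disp
  (fun m => (Z.to_nat (Z.sub 2 m.1.2.1), zhalf (Z.sub (Z.sub 3 m.1.2.1) m.1.2.2), 0%N))
  gbeta2 gbeta3 gbeta3 (gRV T2).
Proof. by vm_compute. Qed.
Lemma check_disp_E0 : gcheck_disp (fun m => (coef_ac m, 0%N)) gbeta1 gbeta1' gbeta1 (gRE T0).
Proof. by vm_compute. Qed.
Lemma check_disp_E1 : gcheck_disp (fun m => (zhalf (Z.sub 1 m.1.2.2), 0%N, 0%N))
  gbeta3 gbeta3 gbeta3 (gRE T1).
Proof. by vm_compute. Qed.
Lemma check_disp_E2 : gcheck_disp (fun m => (Z.to_nat (Z.sub m.1.2.2 1), 0%N, 0%N))
  gbeta2 gbeta2 gbeta2 (gRE T2).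
Proof. by vm_compute. Qed.

Lemma adj_gconj r : adj (toM (gconj r gX)) = toM (gconj r gX).
Proof. by rewrite /gconj !toM_mul toM_adj !adjM adjK -(toM_adj gX) mulrA. Qed.

Lemma check_noncentral i : all (fun r => gin r [:: gone] || ~~ geqb (gconj r gX) gX) (gRV i).
Proof. by case: i; vm_compute. Qed.

Lemma geqb_refl x : geqb x x.
Proof. by rewrite /geqb /gieqb !Z.eqb_refl. Qed.

Lemma chamber_lt_total i x k : GL2Zi x -> k \in KV i -> k \notin KZ ->
  chamber_lt x (x * k) \/ chamber_lt (x * k) x.
Proof.
move=> Gx kK kZ; have Gk := fin_subgroup_GL (fin_KV i) kK.
have Gxk : GL2Zi (x * k) by apply: GL2ZiM.
suff : lexpos (Hform (x * k) - Hform x) \/ lexpos (- (Hform (x * k) - Hform x)).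
  by rewrite opprB => -[l|l]; [left|right].
have [r [rR rZ ->]] := Hform_K x kK; rewrite -mulNr -mulrN.
apply: pos_total; first exact: GL2Zi_unit.
  by rewrite adjB adj_gconj -toM_adj.
have := allP (check_noncentral i) r rR; case: (boolP (gin _ _)) => [/rZ kZ'|_ /= /negP n].
  by rewrite kZ' in kZ.
by move=> /eqP; rewrite subr_eq0 => /eqP/toM_inj e; apply: n; rewrite e geqb_refl.
Qed.

Lemma chamber_lt_KZr x y k : GL2Zi x -> k \in KZ -> chamber_lt y x <-> chamber_lt y (x * k).
Proof.
move=> Gx kZ; have Gk := fin_subgroup_GL fin_KZ kZ.
rewrite /chamber_lt Hform_KZ //; split=> -[Gy _ l]; split=> //; exact: GL2ZiM.
Qed.

(** Some element of the edge group displaces [gX] by exactly [b]; if [b] were negative at x, that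
    element would lead to a smaller chamber. *)
Lemma minimal_pos i b x : has (fun r => geqb (gconj r gX) (gadd gX b)) (gRE i) ->
  geqb (gadj b) b -> ~~ geqb b ((gi0, gi0), (gi0, gi0)) ->
  GL2Zi x -> minimal chamber_lt (KE i) x -> pos x (toM b).
Proof.
move=> /hasP[r rR /geqbP e] hb b0 Gx m.
have kK : toM r \in KE i.
  by apply/KP; exists gi1, r; split=> //; rewrite scale1r.
have Gk := fin_subgroup_GL (fin_KE i) kK.
have [||//|n] := @pos_total x (toM b) (GL2Zi_unit Gx).
- by rewrite -toM_adj (geqbP hb).
- rewrite (_ : 0 = toM ((gi0, gi0), (gi0, gi0))); first by move/toM_inj => E; rewrite E in b0.
  by apply/matrixP => i' j; move: i' j; apply: mk2_ord; apply: mk2_ord; rewrite !mxE.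
case: (m _ kK); split=> //; first exact: GL2ZiM.
rewrite Hform_mul -toM_adj -!toM_mul -/(gconj r gX) e -mulrBl -mulrBr.
by rewrite toM_add opprD addrA subrr add0r.
Qed.

Lemma minimal_E0 x : GL2Zi x -> minimal chamber_lt (KE T0) x ->
  pos x (toM gbeta1) /\ pos x (toM gbeta1').
Proof. by move=> Gx m; split; apply: (@minimal_pos T0). Qed.
Lemma minimal_E1 x : GL2Zi x -> minimal chamber_lt (KE T1) x -> pos x (toM gbeta3).
Proof. by move=> Gx m; apply: (@minimal_pos T1). Qed.
Lemma minimal_E2 x : GL2Zi x -> minimal chamber_lt (KE T2) x -> pos x (toM gbeta2).
Proof. by move=> Gx m; apply: (@minimal_pos T2). Qed.

(** The displacements around a vertex are combinations of those around the two edges meeting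
    there. *)
Lemma chamber_minimal_vertex i x : GL2Zi x -> minimal chamber_lt (KE i) x ->
  minimal chamber_lt (KE (nxt (nxt i))) x -> minimal chamber_lt (KV i) x.
Proof.
move=> Gx; case: i => /=.
- move=> /(minimal_E0 Gx)[p1 p1'] /(minimal_E2 Gx) p2; exact: disp_minimal check_disp_V0 _ _ _.
- move=> /(minimal_E1 Gx) p3 /(minimal_E0 Gx)[p1 p1']; exact: disp_minimal check_disp_V1 _ _ _.
- move=> /(minimal_E2 Gx) p2 /(minimal_E1 Gx) p3; exact: disp_minimal check_disp_V2 _ _ _.
Qed.

Lemma sqrD_eq0 (a b : rat) : a ^+ 2 + b ^+ 2 = 0 -> a = 0 /\ b = 0.
Proof.
move=> /eqP; rewrite paddr_eq0 ?sqr_ge0 // !sqrf_eq0 => /andP[/eqP-> /eqP->]; by [].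
Qed.

Lemma rank1_not_lexpos (p p' r r' : rat) : ~ lex4 (- (2 * (p ^+ 2 + p' ^+ 2)))
  (- (2 * (r ^+ 2 + r' ^+ 2))) (- (2 * (p * r + p' * r'))) (- (2 * (p' * r - p * r'))).
Proof.
have := sqr_ge0 p; have := sqr_ge0 p'; have := sqr_ge0 r; have := sqr_ge0 r' => h1 h2 h3 h4.
case=> [l|[e H]]; first by lra.
have [p0 p'0] : p = 0 /\ p' = 0 by apply: sqrD_eq0; lra.
case: H => [l|[_ H]]; first by lra.
rewrite p0 p'0 in H; case: H => [l|[_ l]]; lra.
Qed.

Lemma posN x M : pos x (- M) = lexpos (- (x * M * adj x)).
Proof. by rewrite /pos mulrN mulNr. Qed.

(** These forms are the cusps: transformed by x they become 2 v v^* with v a column of x. Such a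
    form is positive semidefinite, and its first nonzero entry in the lexicographic order is a
    positive diagonal one. *)
Lemma not_pos_cusp x : ~ pos x (- toM (herm 2 0 0 0)) /\ ~ pos x (- toM (herm 0 2 0 0)).
Proof.
have zr2 : zr 2 = 2 by rewrite /zr.
have zr0 : zr Z0 = 0 by rewrite /zr.
rewrite !posN (mk2_eta x) /toM /herm /toC /= zr2 zr0.
move: (x ord0 ord0) (x ord0 ord_max) (x ord_max ord0) (x ord_max ord_max).
move=> [p p'] [q q'] [r r'] [s s'].
rewrite adj_mk2 -!mulmxE !mk2M /lexpos !mxE /=; split.
- have H := @rank1_not_lexpos p p' r r'; apply: contra_not H.
  by congr lex4; ring.
- have H := @rank1_not_lexpos q q' s s'; apply: contra_not H.
  by congr lex4; ring.
Qed.

Lemma posN_comb x b1 b2 b3 c : pos x (- toM b1) -> pos x (- toM b2) -> pos x (- toM b3) ->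
  geqb (gadd b1 (gadd b2 (gadd b2 b3))) c -> pos x (- toM c).
Proof.
move=> p1 p2 p3 /geqbP <-; rewrite !toM_add.
move: (toM b1) (toM b2) (toM b3) p1 p2 p3 => M1 M2 M3 p1 p2 p3; rewrite (opprD M1) (opprD M2 (M2 + M3)) (opprD M2 M3).
exact: posD p1 (posD p2 (posD p2 p3)).
Qed.

(** Otherwise beta2, beta3 and one of beta1, beta1' would be negative at x. But beta1 + 2 beta2 +
    beta3 is the form of a cusp, and so is the same sum with beta1', and neither is negative. *)
Lemma chamber_minimal_edge x : GL2Zi x -> exists i, minimal chamber_lt (KE i) x.
Proof.
move=> Gx; have tot b : geqb (gadj b) b -> ~~ geqb b ((gi0, gi0), (gi0, gi0)) ->
    pos x (toM b) \/ pos x (- toM b).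
  move=> hb b0; apply: pos_total; first exact: GL2Zi_unit.
    by rewrite -toM_adj (geqbP hb).
  rewrite (_ : 0 = toM ((gi0, gi0), (gi0, gi0))); first by move/toM_inj => E; rewrite E in b0.
  by apply/matrixP => i' j; move: i' j; apply: mk2_ord; apply: mk2_ord; rewrite !mxE.
have [c1 c2] := not_pos_cusp x.
case: (tot gbeta3 isT isT) => p3.
  by exists T1; exact: (disp_minimal check_disp_E1 p3 p3 p3).
case: (tot gbeta2 isT isT) => p2.
  by exists T2; exact: (disp_minimal check_disp_E2 p2 p2 p2).
case: (tot gbeta1 isT isT) => p1; last by case: c1; exact: (posN_comb (c := herm 2 0 0 0) p1 p2 p3 isT).
case: (tot gbeta1' isT isT) => p1'; last by case: c2; exact: (posN_comb (c := herm 0 2 0 0) p1' p2 p3 isT).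
by exists T0; exact: (disp_minimal check_disp_E0 p1 p1' p1).
Qed.

Lemma lex4_ge0 a b c d : lex4 a b c d -> 0 <= a.
Proof. by case=> [/ltW|[->]]. Qed.

(* The only cusps in the closure of the triangle are infinity and 0. *)
Lemma minimal_first_row x : GL2Zi x -> (forall i, minimal chamber_lt (KE i) x) ->
  x ord0 ord0 = 0 \/ x ord0 ord_max = 0.
Proof.
move=> Gx m; have [p1 p1'] := minimal_E0 Gx (m T0).
have p3 := minimal_E1 Gx (m T1); have p2 := minimal_E2 Gx (m T2).
have zr2 : zr 2 = 2 by rewrite /zr.
have zr1 : zr 1 = 1 by rewrite /zr.
have zrm1 : zr (-1) = -1 by rewrite /zr.
have zr0 : zr Z0 = 0 by rewrite /zr.
have zrm2 : zr (-2) = -2 by rewrite /zr.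
move: (lex4_ge0 p1) (lex4_ge0 p1') (lex4_ge0 p2) (lex4_ge0 p3); clear p1 p1' p2 p3 m Gx.
rewrite (mk2_eta x) /toM /herm /toC /= zr2 zr1 zrm1 zrm2 zr0.
move: (x ord0 ord0) (x ord0 ord_max) (x ord_max ord0) (x ord_max ord_max).
move=> [p p'] [q q'] [r r'] [s s'].
rewrite adj_mk2 -!mulmxE !mk2M !mxE /=.
set A := p ^+ 2 + p' ^+ 2; set B := q ^+ 2 + q' ^+ 2.
set u := p * q + p' * q'; set v := p' * q - p * q'.
rewrite [X in 0 <= X](_ : _ = 2 * A + 4 * u); last by rewrite /A /u; ring.
rewrite [X in _ -> 0 <= X -> _](_ : _ = 2 * B + 4 * u); last by rewrite /B /u; ring.
rewrite [X in _ -> _ -> 0 <= X -> _](_ : _ = - 2 * u - 2 * v); last by rewrite /u /v; ring.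
rewrite [X in _ -> _ -> _ -> 0 <= X -> _](_ : _ = 4 * v); last by rewrite /v; ring.
(* A and B are the norms of the entries of the first row, and u + iv is the first entry times the
   conjugate of the second. The inequalities give 4 u^2 <= A B = u^2 + v^2 <= 2 u^2, so A B = 0. *)
have uv : u ^+ 2 + v ^+ 2 = A * B by rewrite /A /B /u /v; ring.
have A0 : 0 <= A by rewrite addr_ge0 ?sqr_ge0.
have B0 : 0 <= B by rewrite addr_ge0 ?sqr_ge0.
move=> h1 h2 h3 h4.
have v0 : 0 <= v by lra.
have vu : v <= - u by lra.
have uA : 2 * (- u) <= A by lra.
have uB : 2 * (- u) <= B by lra.
have u2 : 4 * u ^+ 2 <= A * B.
  have -> : 4 * u ^+ 2 = (2 * (- u)) * (2 * (- u)) by ring.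
  by apply: ler_pM => //; lra.
have v2 : v ^+ 2 <= u ^+ 2 by rewrite -[u ^+ 2]sqrrN lerXn2r // nnegrE; lra.
have : A * B = 0 by have := mulr_ge0 A0 B0; have := sqr_ge0 u; lra.
move/eqP; rewrite mulf_eq0 => /orP[] /eqP /sqrD_eq0[-> ->]; [left|right]; by [].
Qed.

(** * Invariant functions on the base chambers *)

Definition lowtri (a : Qi) : G := mk2 1 0 a 1.

Lemma lowtri_GL a : gauss_int a -> GL2Zi (lowtri a).
Proof.
move=> ai; split; first by apply: gauss_int_mx_mk2; do ?[exact: gauss_int1|exact: gauss_int0].
exists (mk2 1 0 (- a) 1); split.
  apply: gauss_int_mx_mk2; [exact: gauss_int1|exact: gauss_int0| |exact: gauss_int1].
  by case: a ai => b c [? ?]; split; rewrite /= rpredN.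
by rewrite !mk2M mk2_1; split; congr mk2; ring.
Qed.

Lemma mulr_ge0_eq1l (A B : int) : A * B = 1 -> 0 <= A -> 0 <= B -> A = 1.
Proof.
move=> e a0 b0.
have A1 : 1 <= A by rewrite -gtz0_ge1 lt0r a0 andbT; apply/eqP => z; move: e; rewrite z mul0r.
have B1 : 1 <= B by rewrite -gtz0_ge1 lt0r b0 andbT; apply/eqP => z; move: e; rewrite z mulr0.
by apply/eqP; rewrite eq_le A1 andbT -e ler_peMr.
Qed.

Lemma gauss_unit (x y : Qi) : gauss_int x -> gauss_int y -> x * y = 1 ->
  exists2 u, u \in gunits & x = toC u.
Proof.
case: x y => [a b] [c d] [/= /intrP[m ->] /intrP[n ->]] [/= /intrP[k ->] /intrP[l ->]].
move=> [e1 e2].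
have {}e1 : m * k - n * l = 1 by apply: (@intr_inj rat); rewrite intrB !intrM.
have {}e2 : m * l + n * k = 0 by apply: (@intr_inj rat); rewrite intrD !intrM.
have norm : (m ^+ 2 + n ^+ 2) * (k ^+ 2 + l ^+ 2) = 1.
  have -> : (m ^+ 2 + n ^+ 2) * (k ^+ 2 + l ^+ 2) = (m * k - n * l) ^+ 2 + (m * l + n * k) ^+ 2 by ring.
  by rewrite e1 e2.
have mn : m ^+ 2 + n ^+ 2 = 1.
  apply: (mulr_ge0_eq1l norm); by rewrite addr_ge0 ?sqr_ge0.
have bd (x y : int) : x ^+ 2 + y ^+ 2 = 1 -> [\/ x = 1, x = 0 | x = -1].
  move=> xy; have y0 := sqr_ge0 y.
  have x2 : x ^+ 2 <= 1 by rewrite -xy lerDl.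
  have [x1 x1'] : x <= 1 /\ -1 <= x by rewrite expr2 in x2; split; nia.
  have [?|[?|?]] : x = 1 \/ x = 0 \/ x = -1 by lia.
  - by apply: Or31.
  - by apply: Or32.
  - by apply: Or33.
have nm : n ^+ 2 + m ^+ 2 = 1 by rewrite addrC.
case: (bd m n mn) => m1; case: (bd n m nm) => n1; rewrite m1 n1 in mn *; try by [].
- by exists gi1.
- by exists gii.
- by exists (Z0, Zneg xH).
- by exists giN1.
Qed.

Section Base.
Variables (V : lmodType Qi) (F : G -> V).
Hypothesis F_rinv : forall i, rinv (KV i) F.

Lemma F_word x (w : seq gm) : GL2Zi x ->
  all (fun k => has (fun i => gin k (gRV i)) [:: T0; T1; T2]) w ->
  F (x * toM (foldr gmul gone w)) = F x.
Proof.
elim: w x => [|k w IH] x Gx /=; first by rewrite toM_one mulr1.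
case/andP=> kK wK.
have [i kV] : exists i, toM k \in KV i.
  by case/or4P: kK => // /ginP ?; [exists T0|exists T1|exists T2].
have Gk := fin_subgroup_GL (fin_KV i) kV.
rewrite toM_mul mulrA (IH _ (GL2ZiM Gx Gk) wK); exact: (@F_rinv i).
Qed.

(** [g_eps] times diag(-1, 1) is the translation by 1; conjugation by diag(u, 1) turns it into the
    translation by u, and conjugation by [g_sigma] makes it lower triangular. Every letter lies in a
    vertex group. *)
Definition lowtri_word (u : gi) : seq gm :=
  [:: g_sigma; gdiag u gi1; g_eps; gdiag giN1 gi1; gdiag (giconj u) gi1; g_sigma].

Lemma lowtriD a b : lowtri a * lowtri b = lowtri (a + b).
Proof. by rewrite -mulmxE mk2M; congr mk2; ring. Qed.

Lemma F_lowtri_step x u : GL2Zi x -> u \in gunits -> F (x * lowtri (toC u)) = F x.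
Proof.
move=> Gx ug; have chk : all (fun u =>
    all (fun k => has (fun i => gin k (gRV i)) [:: T0; T1; T2]) (lowtri_word u) &&
    geqb (foldr gmul gone (lowtri_word u)) ((gi1, gi0), (u, gi1))) gunits by vm_compute.
have /andP[wK /geqbP e] := allP chk u ug.
by rewrite -[RHS](F_word Gx wK) e.
Qed.

Lemma F_lowtri_mul a u (n : nat) : gauss_int a -> u \in gunits ->
  F (lowtri (a + toC u *+ n)) = F (lowtri a).
Proof.
move=> ai ug; have ui := gauss_int_toC u.
have ni k : gauss_int (toC u *+ k).
  by elim: k => [|k IH]; [exact: gauss_int0|rewrite mulrS; exact: gauss_intD].
elim: n => [|n IH]; first by rewrite addr0.
rewrite mulrSr addrA -[RHS]IH -(lowtriD (a + toC u *+ n)) F_lowtri_step //.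
by apply: lowtri_GL; apply: gauss_intD.
Qed.

Lemma F_lowtri a : gauss_int a -> F (lowtri a) = F 1.
Proof.
have z0 : gauss_int 0 := gauss_int0.
have cases (m : int) : exists (b : bool) (k : nat), m%:~R = (if b then k%:R else - k%:R) :> rat.
  case: m => k; first by exists true, k.
  by exists false, k.+1; rewrite NegzE intrN.
have Cn u k : toC u *+ k = Complex (k%:R * zr u.1) (k%:R * zr u.2).
  by rewrite -[LHS]mulr_natl Qi_natr /toC complexM !mul0r subr0 addr0.
case: a => [x y] [/= /intrP[m ->] /intrP[n ->]].
have [b1 [k1 ->]] := cases m; have [b2 [k2 ->]] := cases n.
have -> : Complex (if b1 then k1%:R else - k1%:R) (if b2 then k2%:R else - k2%:R) =
  0 + toC (if b1 then gi1 else giN1) *+ k1 + toC (if b2 then gii else (Z0, Zneg xH)) *+ k2.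
  have zr0 : zr Z0 = 0 by [].
  have zr1 : zr (Zpos xH) = 1 by [].
  have zrm1 : zr (Zneg xH) = -1 by [].
  rewrite !Cn add0r complexD.
  by case: b1; case: b2; rewrite /= !(zr0, zr1, zrm1); congr Complex; ring.
rewrite F_lowtri_mul; last 2 first.
- rewrite add0r; elim: k1 => [|k IH]; first exact: gauss_int0.
  by rewrite mulrS; apply: gauss_intD => //; apply: gauss_int_toC.
- by case: b2.
by rewrite F_lowtri_mul //; [rewrite -[1]/(1%:M) mk2_1|case: b1].
Qed.

(** x is a lower unipotent matrix times a diagonal matrix of units; the latter belongs to the vertex
    group of [T2]. *)
Lemma F_lower x : GL2Zi x -> x ord0 ord_max = 0 -> F x = F 1.
Proof.
move=> Gx; have [xi [y [yi [xy yx]]]] := Gx.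
move: xi yi xy yx Gx; rewrite (mk2_eta x) (mk2_eta y) !mxE /=.
have En M : gauss_int_mx M -> [/\ gauss_int (M ord0 ord0), gauss_int (M ord0 ord_max),
  gauss_int (M ord_max ord0) & gauss_int (M ord_max ord_max)] by move=> Mi; split.
move: (x ord0 ord0) (x ord0 ord_max) (x ord_max ord0) (x ord_max ord_max) => p q r s.
move: (y ord0 ord0) (y ord0 ord_max) (y ord_max ord0) (y ord_max ord_max) => p' q' r' s'.
move=> /En + /En; rewrite !mxE /= => -[pi qi ri si] [pi' qi' ri' si'].
rewrite !mk2M mk2_1 => /mk2_inj[e1 e2 e3 e4] _ Gx q0; move: e1 e2 e3 e4 Gx; rewrite q0.
rewrite !mul0r !addr0 => e1 e2 e3 e4 Gx.
have p0 : p != 0 by apply/eqP => p0; move: e1; rewrite p0 mul0r => /esym/eqP; rewrite oner_eq0.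
have q'0 : q' = 0 by move/eqP: e2; rewrite mulf_eq0 (negPf p0) /= => /eqP.
have [u ug pu] := gauss_unit pi pi' e1.
have [v vg sv] : exists2 v, v \in gunits & s = toC v.
  by apply: gauss_unit si si' _; rewrite -e4 q'0 mulr0 add0r.
have -> : mk2 p 0 r s = lowtri (r * p') * toM (gdiag u v).
  rewrite /toM /= -pu -sv (_ : toC gi0 = 0) // -mulmxE mk2M; congr mk2; rewrite ?mulr0 ?mul0r ?mul1r ?addr0 ?add0r //.
  by rewrite -mulrA [p' * p]mulrC e1 mulr1.
have chk : all (fun u => all (fun v => gin (gdiag u v) (gRV T2)) gunits) gunits by vm_compute.
rewrite (F_rinv (i := T2)); last 2 first.
- by apply: lowtri_GL; apply: gauss_intM.
- by apply: ginP; apply: (allP (allP chk u ug)).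
by apply: F_lowtri; apply: gauss_intM.
Qed.

Lemma F_base x : GL2Zi x -> (forall i, minimal chamber_lt (KE i) x) -> F x = F 1.
Proof.
move=> Gx m; case: (minimal_first_row Gx m) => z; last exact: F_lower.
(* Right multiplication by [g_sigma] exchanges the columns, which reduces this case to the other
   one. *)
have sK : toM g_sigma \in KV T2 by apply: ginP; vm_compute.
rewrite -(F_rinv (i := T2) Gx sK); apply: F_lower.
  by apply: GL2ZiM => //; apply: (fin_subgroup_GL (fin_KV T2)).
rewrite (mk2_eta x) z -mulmxE mk2M mxE /= (_ : toC gi0 = 0) //.
by rewrite mul0r mulr0 addr0.
Qed.

End Base.

Section Exactness.
Variable V : lmodType Qi.

Lemma triangle_exact0 (F : G -> V) : (forall i, rinv (KV i) F) -> forall x, GL2Zi x -> F x = F 1.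
Proof.
move=> Fi; apply: (descent_exact0 fin_KE sub_KEV chamber_lt_wf
  chamber_lt_total chamber_lt_KZr) => //.
by move=> x Gx m; apply: F_base.
Qed.

Lemma triangle_exact1 (f : tri -> G -> V) : (forall i, rinv (KE i) (f i)) ->
  (forall x, GL2Zi x -> tsum (f^~ x) = 0) ->
  exists F : tri -> G -> V, (forall i, rinv (KV i) (F i)) /\
    forall i x, GL2Zi x -> f i x = F i x - F (nxt i) x.
Proof.
exact: (descent_exact1 fin_KV fin_KE fin_KZ sub_KEV sub_KEV' sub_KZE chamber_lt_wf
  chamber_lt_total chamber_lt_KZr chamber_minimal_vertex chamber_minimal_edge).
Qed.

Lemma triangle_exact2 (f : G -> V) : rinv KZ f ->
  exists F : tri -> G -> V, (forall i, rinv (KE i) (F i)) /\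
    forall x, GL2Zi x -> f x = tsum (F^~ x).
Proof.
exact: (descent_exact2 fin_KE fin_KZ sub_KEV sub_KZE chamber_lt_wf
  chamber_lt_total chamber_lt_KZr chamber_minimal_edge).
Qed.

End Exactness.

(** * Dimensions of subquotients *)

(* H^j is the subquotient Zm / Bm as soon as cocycles correspond to vectors of Zm under a
   linear relation R for which coboundaries correspond to vectors of Bm. *)
Lemma H_dim_of_relation (V : lmodType Qi) (act : G -> V -> V) (j m p q : nat)
    (Zm : 'M[Qi]_(p, m)) (Bm : 'M[Qi]_(q, m)) (R : (seq G -> V) -> 'rV[Qi]_m -> Prop) :
  (Bm <= Zm)%MS ->
  R (fun=> 0) 0 ->
  (forall a z w z' w', R z w -> R z' w' -> R (fun s => z s + a *: z' s) (w + a *: w')) ->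
  (forall z, is_cocycle act j z -> exists2 w, R z w & (w <= Zm)%MS) ->
  (forall w, (w <= Zm)%MS -> exists2 z, is_cocycle act j z & R z w) ->
  (forall z w, R z w -> is_coboundary act j z <-> (w <= Bm)%MS) ->
  H_dim act j (\rank Zm - \rank Bm)%N.
Proof.
move=> sBZ R0 Rlin Rex Rco Rcob; set D := (Zm :\: Bm)%MS.
have rD : (\rank Zm - \rank Bm)%N = \rank D.
  rewrite -(mxrank_cap_compl Zm Bm); rewrite (eqmx_rank (_ : (Zm :&: Bm == Bm)%MS)); last first.
    by rewrite capmxSr sub_capmx sBZ submx_refl.
  by rewrite addKn.
have sDZ : (D <= Zm)%MS by apply: diffmxSl.
rewrite rD; pose E := row_base D.
have Ei i : (row i E <= Zm)%MS.
  by apply: submx_trans (row_sub i E) _; rewrite eq_row_base.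
have [zs Hzs] := functional_choice (fun i => let: ex_intro2 z zc zr := Rco _ (Ei i) in ex_intro (fun z => is_cocycle act j z /\ R z (row i E)) z (conj zc zr)).
have Rsum (a : 'I_(\rank D) -> Qi) : R (fun s => \sum_(k < \rank D) a k *: zs k s)
    (\sum_k a k *: row k E).
  have H (r : seq 'I_(\rank D)) : R (fun s => \sum_(k <- r) a k *: zs k s) (\sum_(k <- r) a k *: row k E).
    elim: r => [|k r IH].
      by rewrite big_nil; have := R0; congr R; apply: functional_extensionality => s; rewrite big_nil.
    rewrite big_cons addrC; have := Rlin (a k) _ _ _ _ IH (Hzs k).2; congr R.
    by apply: functional_extensionality => s; rewrite big_cons addrC.
  exact: H.
have sumE (a : 'I_(\rank D) -> Qi) : \sum_k a k *: row k E = (\row_k a k) *m E.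
  by rewrite mulmx_sum_row; apply: eq_bigr => k _; rewrite mxE.
exists zs; split; first by move=> k; case: (Hzs k).
split=> [a /(Rcob _ _ (Rsum a)) aB k|z /Rex[w zw wZ]].
  move: aB; rewrite sumE => aB.
  have : ((\row_k' a k') *m E <= D :&: Bm)%MS.
    by rewrite sub_capmx aB andbT (submx_trans (submxMl _ _)) // eq_row_base.
  rewrite capmx_diff submx0 => /eqP a0.
  have : (\row_k a k) = 0 by apply: (row_free_inj (row_base_free D)); rewrite mul0mx.
  by move/rowP/(_ k); rewrite !mxE.
have : (w <= D + Bm)%MS.
  apply: submx_trans wZ _; apply: (submx_trans _ (addsmxS (submx_refl D) (capmxSr Zm Bm))).
  by rewrite addsmx_diff_cap_eq.
case/sub_addsmxP => -[u v] /= we.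
have : (u *m D <= E)%MS by rewrite eq_row_base submxMl.
case/submxP => a ua; exists (fun k => a 0 k).
have R' := Rlin (-1) _ _ _ _ zw (Rsum (fun k => a 0 k)).
have : is_coboundary act j (fun s => z s + -1 *: \sum_(k < \rank D) a 0 k *: zs k s).
  apply/(Rcob _ _ R'); rewrite sumE we ua scaleN1r.
  rewrite (_ : \row_k a 0 k = a); last by apply/rowP => k; rewrite mxE.
  by rewrite addrC addKr submxMl.
congr is_coboundary; apply: functional_extensionality => s.
by rewrite scaleN1r.
Qed.

(** Write P = C R with C of full column rank and R of full row rank. Cancelling in P P = P gives R C
    = 1, of size the rank, and tr (C R) = tr (R C). *)
Lemma mxrank_idempotent (F : fieldType) m (P : 'M[F]_m) : P *m P = P -> \tr P = (\rank P)%:R.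
Proof.
move=> PP; have e : row_base P *m col_base P = 1%:M.
  have := PP; rewrite -{1 2 3}(mulmx_base P) => H.
  have {}H : col_base P *m (row_base P *m col_base P) = col_base P *m 1%:M.
    apply: (row_free_inj (row_base_free P)); rewrite mulmx1 -[RHS]H !mulmxA //.
  apply: trmx_inj; apply: (row_free_inj (A := (col_base P)^T)).
    by rewrite /row_free mxrank_tr; apply: col_base_full.
  by rewrite -!trmx_mul H.
by rewrite -{1}(mulmx_base P) mxtrace_mulC e mxtrace1.
Qed.

Section Triples.
Variable N : nat.

Definition tri_row (y : tri -> 'rV[Qi]_N) : 'rV[Qi]_(N + (N + N)) :=
  row_mx (y T0) (row_mx (y T1) (y T2)).
Definition row_tri (w : 'rV[Qi]_(N + (N + N))) (i : tri) : 'rV[Qi]_N :=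
  match i with T0 => lsubmx w | T1 => lsubmx (rsubmx w) | T2 => rsubmx (rsubmx w) end.

Lemma tri_rowK y i : row_tri (tri_row y) i = y i.
Proof. by case: i; rewrite /= /tri_row ?row_mxKr ?row_mxKl. Qed.

Lemma row_triK w : tri_row (row_tri w) = w.
Proof. by rewrite /tri_row /= !hsubmxK. Qed.

Lemma row_tri_linear a w w' i : row_tri (w + a *: w') i = row_tri w i + a *: row_tri w' i.
Proof. by case: i; rewrite /= !linearD !linearZ. Qed.

Lemma row_tri0 i : row_tri 0 i = 0.
Proof. by case: i; rewrite /= !linear0. Qed.

Definition tri_mx (A : tri -> 'M[Qi]_N) : 'M[Qi]_(N + (N + N)) :=
  block_mx (A T0) 0 0 (block_mx (A T1) 0 0 (A T2)).

Lemma mul_tri_mx y A : tri_row y *m tri_mx A = tri_row (fun i => y i *m A i).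
Proof. by rewrite /tri_row /tri_mx !mul_row_block !mulmx0 !addr0 !add0r. Qed.

Lemma rank_tri_mx A : \rank (tri_mx A) = (\rank (A T0) + \rank (A T1) + \rank (A T2))%N.
Proof. by rewrite !rank_diag_block_mx addnA. Qed.

Lemma sub_tri_mx w A : (w <= tri_mx A)%MS <-> forall i, (row_tri w i <= A i)%MS.
Proof.
split=> [/submxP[u ->] i|H].
  by rewrite -(row_triK u) mul_tri_mx tri_rowK submxMl.
have [u Hu] := functional_choice (fun i => elimT submxP (H i)).
apply/submxP; exists (tri_row u); rewrite mul_tri_mx -(row_triK w) /tri_row.
by rewrite -!Hu.
Qed.

Definition diff_mx : 'M[Qi]_(N + (N + N)) :=
  block_mx 1%:M (row_mx 0 (- 1%:M)) (col_mx (- 1%:M) 0) (block_mx 1%:M 0 (- 1%:M) 1%:M).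
Definition sum_mx : 'M[Qi]_(N + (N + N), N) := col_mx 1%:M (col_mx 1%:M 1%:M).

Lemma mul_diff_mx y : tri_row y *m diff_mx = tri_row (fun i => y i - y (nxt i)).
Proof.
rewrite /tri_row /diff_mx mul_row_block mul_row_col mul_row_block mul_mx_row.
rewrite !mulmx0 !mulmxN !mulmx1 !add0r addr0 add_row_mx.
by congr row_mx; congr row_mx; rewrite ?add0r // addrC.
Qed.

Lemma mul_sum_mx y : tri_row y *m sum_mx = tsum y.
Proof. by rewrite /tri_row /sum_mx !mul_row_col !mulmx1 /tsum addrA. Qed.

End Triples.

(** * The cohomology as a subquotient of invariants *)

Section Averages.
Variables (n : nat) (K : seq G).
Hypothesis fK : fin_subgroup K.

(** The Reynolds projector: its row space is V^K, so its trace is the dimension of V^K. *)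
Definition avgmx : 'M[Qi]_n.+1 := (size K)%:R^-1 *: \sum_(k <- K) Smx n k.

Lemma mul_avgmx v : v *m avgmx = avg K (fun k => @symact n k v).
Proof.
rewrite /avgmx /avg -scalemxAr mulmx_sumr; congr (_ *: _).
by apply: eq_bigr => k _; rewrite symactE.
Qed.

Lemma fixed_mul_avgmx v : fixed_by (@symact n) K v -> v *m avgmx = v.
Proof. by move=> fv; rewrite mul_avgmx; apply: avg_const. Qed.

Lemma mul_avgmx_fixed v : fixed_by (@symact n) K (v *m avgmx).
Proof.
move=> k kK; rewrite mul_avgmx (act_avg (@symact_linear n)).
rewrite -[RHS](avg_translate fK (fun k => symact k v) kK).
by apply: eq_avg => k' _; rewrite symactM.
Qed.

Lemma sub_avgmx v : (v <= avgmx)%MS <-> fixed_by (@symact n) K v.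
Proof.
split=> [/submxP[u ->]|fv]; first exact: mul_avgmx_fixed.
by rewrite -(fixed_mul_avgmx fv) submxMl.
Qed.

Lemma avgmx_idempotent : avgmx *m avgmx = avgmx.
Proof.
apply/row_matrixP => i; rewrite row_mul fixed_mul_avgmx //.
by apply/sub_avgmx; apply: row_sub.
Qed.

End Averages.

Section Cohomology.
Variable n : nat.

Local Notation lin := (@symact_linear n).
Local Notation one := (@symact1 n).
Local Notation mul := (@symactM n).
Local Notation VE := 'rV[Qi]_n.+1.

Definition UV := tri_mx (fun i => avgmx n (KV i)).
Definition UE := tri_mx (fun i => avgmx n (KE i)).
Definition dmx := diff_mx n.+1.
Definition smx := sum_mx n.+1.

Lemma sub_UV w : (w <= UV)%MS <-> forall i, fixed_by (@symact n) (KV i) (row_tri w i).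
Proof.
rewrite sub_tri_mx; split=> H i; by apply/(@sub_avgmx n _ (fin_KV i) _).
Qed.

Lemma sub_UE w : (w <= UE)%MS <-> forall i, fixed_by (@symact n) (KE i) (row_tri w i).
Proof.
rewrite sub_tri_mx; split=> H i; by apply/(@sub_avgmx n _ (fin_KE i) _).
Qed.

Lemma mul_dmx w : w *m dmx = tri_row (fun i => row_tri w i - row_tri w (nxt i)).
Proof. by rewrite -{1}(row_triK w) mul_diff_mx. Qed.

Lemma mul_smx w : w *m smx = tsum (row_tri w).
Proof. by rewrite -{1}(row_triK w) mul_sum_mx. Qed.

Lemma sub_UV_dmx w : (w <= UV *m dmx)%MS <-> exists v,
  (forall i, fixed_by (@symact n) (KV i) (v i)) /\ forall i, row_tri w i = v i - v (nxt i).
Proof.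
split=> [/submxP[u ->]|[v [fv wv]]].
  exists (row_tri (u *m UV)); split.
    by apply/sub_UV; apply: submxMl.
  by move=> i; rewrite mulmxA mul_dmx tri_rowK.
rewrite -(row_triK w) (_ : tri_row _ = tri_row v *m dmx).
  by apply: submxMr; apply/sub_UV => i; rewrite tri_rowK.
by rewrite mul_diff_mx /tri_row !wv.
Qed.

Lemma sub_UE_smx y : (y <= UE *m smx)%MS <-> exists v,
  (forall i, fixed_by (@symact n) (KE i) (v i)) /\ y = tsum v.
Proof.
split=> [/submxP[u ->]|[v [fv ->]]].
  exists (row_tri (u *m UE)); split.
    by apply/sub_UE; apply: submxMl.
  by rewrite mulmxA mul_smx.
rewrite -mul_sum_mx; apply: submxMr; apply/sub_UE => i; rewrite tri_rowK; exact: fv.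
Qed.

Lemma fixed_subset (K K' : seq G) v : {subset K <= K'} ->
  fixed_by (@symact n) K' v -> fixed_by (@symact n) K v.
Proof. by move=> s f k /s /f. Qed.

Lemma fixedB (K : seq G) u v : fixed_by (@symact n) K u -> fixed_by (@symact n) K v ->
  fixed_by (@symact n) K (u - v).
Proof. by move=> fu fv k kK; rewrite symactE mulmxBl -!symactE fu ?fv. Qed.

Lemma fixedD (K : seq G) u v : fixed_by (@symact n) K u -> fixed_by (@symact n) K v ->
  fixed_by (@symact n) K (u + v).
Proof. by move=> fu fv k kK; rewrite symactE mulmxDl -!symactE fu ?fv. Qed.

Lemma H0_dim : H_dim (@symact n) 0 (\rank (UV :&: kermx dmx)%MS).
Proof.
(* In degree 0 the coboundaries correspond to the zero space. *)
have -> : \rank (UV :&: kermx dmx)%MS = (\rank (UV :&: kermx dmx)%MS -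
  \rank (0%R : 'M[Qi]_(1, n.+1 + (n.+1 + n.+1))))%N by rewrite mxrank0 subn0.
apply: (H_dim_of_relation (R := fun z w => rel0 z (row_tri w))) => //.
- exact: sub0mx.
- by move=> i; rewrite row_tri0.
- by move=> a z w z' w' r r' i; rewrite row_tri_linear r r'.
- move=> z /(rel0_ex fin_KV)[y [r fy ey]]; exists (tri_row y).
    by move=> i; rewrite tri_rowK.
  rewrite sub_capmx; apply/andP; split; first by apply/sub_UV => i; rewrite tri_rowK.
  have E i : y i - y (nxt i) = 0 by rewrite -ey subrr.
  by apply/sub_kermxP; rewrite mul_diff_mx /tri_row !E !row_mx0.
- move=> w; rewrite sub_capmx => /andP[/sub_UV fw /sub_kermxP]; rewrite mul_dmx => e.
  have [|z [zz r]] := rel0_cocycle one mul (@triangle_exact0 _) fw; last by exists z.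
  by move=> i; apply/eqP; rewrite -subr_eq0; apply/eqP;
    rewrite -(tri_rowK (fun i => row_tri w i - row_tri w (nxt i))) e row_tri0.
- move=> z w r; rewrite (rel0_coboundary _ r); split=> [e|/submxP[u ->] i].
    by rewrite -(row_triK w) /tri_row !e !row_mx0 sub0mx.
  by rewrite mulmx0 row_tri0.
Qed.

Lemma H1_dim : H_dim (@symact n) 1 (\rank (UE :&: kermx smx)%MS - \rank (UV *m dmx)%R)%N.
Proof.
apply: (H_dim_of_relation (R := fun z w => rel1 (@symact n) KV z (row_tri w))) => //.
- apply/rV_subP => w /sub_UV_dmx[v [fv wv]]; rewrite sub_capmx; apply/andP; split.
    apply/sub_UE => i; rewrite wv; apply: fixedB.
      exact: fixed_subset (@sub_KEV i) (fv i).
    exact: fixed_subset (@sub_KEV' i) (fv (nxt i)).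
  apply/sub_kermxP; rewrite mul_smx (_ : row_tri w = fun i => v i - v (nxt i)) ?tsum_nxt //.
  exact: functional_extensionality.
- rewrite (_ : row_tri 0 = fun=> 0); first exact: (rel1_0 lin).
  by apply: functional_extensionality => i; rewrite row_tri0.
- move=> a z w z' w' r r'.
  rewrite (_ : row_tri (w + a *: w') = fun i => row_tri w i + a *: row_tri w' i).
    exact: (rel1_comb lin a r r').
  by apply: functional_extensionality => i; rewrite row_tri_linear.
- move=> z /(rel1_ex lin one mul fin_KV fin_KE sub_KEV sub_KEV')[y [r fy ey]].
  have E : row_tri (tri_row y) = y by apply: functional_extensionality => i; rewrite tri_rowK.
  exists (tri_row y); first by rewrite E.
  rewrite sub_capmx; apply/andP; split; first by apply/sub_UE; rewrite E.
  by apply/sub_kermxP; rewrite mul_sum_mx.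
- move=> w; rewrite sub_capmx => /andP[/sub_UE fw /sub_kermxP]; rewrite mul_smx => e.
  have [z [zz r]] := rel1_cocycle lin one mul fin_KV (@triangle_exact0 _) (@triangle_exact1 _) fw e.
  by exists z.
- move=> z w r; rewrite sub_UV_dmx.
  exact: (rel1_coboundary lin one mul fin_KV (@triangle_exact0 _) r).
Qed.

Lemma H2_dim : H_dim (@symact n) 2 (\rank (avgmx n KZ) - \rank (UE *m smx)%R)%N.
Proof.
apply: (H_dim_of_relation (R := fun z w => rel2 (@symact n) KV KE z w)) => //.
- apply/rV_subP => w /sub_UE_smx[v [fv ->]]; apply/(@sub_avgmx n _ fin_KZ _).
  have fz i : fixed_by (@symact n) KZ (v i) by apply: fixed_subset (@sub_KZE i) (fv i).
  by apply: fixedD => //; apply: fixedD.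
- exact: (rel2_0 lin).
- by move=> a z w z' w' r r'; apply: (rel2_comb lin).
- move=> z /(rel2_ex lin one mul fin_KV fin_KE fin_KZ sub_KEV sub_KEV' sub_KZE)[y [r fy]].
  by exists y => //; apply/(@sub_avgmx n _ fin_KZ _).
- move=> w /(@sub_avgmx n _ fin_KZ _) fw.
  have [z [zz r]] := rel2_cocycle lin one mul fin_KV (@triangle_exact0 _)
    (@triangle_exact1 _) (@triangle_exact2 _) fw.
  by exists z.
- move=> z w r; rewrite sub_UE_smx.
  exact: (rel2_coboundary lin one mul fin_KV fin_KE sub_KEV sub_KEV' (@triangle_exact0 _)
    (@triangle_exact1 _) r).
Qed.

Lemma H_dim_vanishing j : H_dim (@symact n) j.+3 0.
Proof.
exists (fun _ _ => 0); split; first by case.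
split; first by move=> a _ [].
move=> z /(cohomology_vanishing lin one mul fin_KV fin_KE fin_KZ sub_KEV sub_KEV' sub_KZE
  (@triangle_exact0 _) (@triangle_exact1 _) (@triangle_exact2 _)) [b zb].
by exists (fun=> 0), b => s sz Gs; rewrite big_ord0 subr0 zb.
Qed.

(** Rank-nullity for both differentials; the two inequalities keep the subtractions of natural
    numbers from truncating. *)
Lemma euler_arith (a b c z a' b' c' e rV rE d0 s0 k0 k1 : nat) :
  (a + b + c + z = a' + b' + c' + e)%N -> rV = (a + b + c)%N -> rE = (a' + b' + c')%N ->
  (d0 + k0)%N = rV -> (s0 + k1)%N = rE -> (d0 <= k1)%N -> (s0 <= z)%N ->
  e%:Z = k0%:Z + (- (k1 - d0)%N%:Z + (z - s0)%N%:Z).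
Proof. lia. Qed.

Lemma euler_char_rank (e : nat) :
  (\rank (avgmx n (KV T0)) + \rank (avgmx n (KV T1)) + \rank (avgmx n (KV T2)) +
   \rank (avgmx n KZ) =
   \rank (avgmx n (KE T0)) + \rank (avgmx n (KE T1)) + \rank (avgmx n (KE T2)) + e)%N ->
  euler_char_is (@symact n) e%:Z.
Proof.
move=> ranks; exists 2, (fun j => match j with
  | 0 => \rank (UV :&: kermx dmx)%MS
  | 1 => (\rank (UE :&: kermx smx)%MS - \rank (UV *m dmx)%R)%N
  | 2 => (\rank (avgmx n KZ) - \rank (UE *m smx)%R)%N
  | _ => 0%N end).
split; first by move=> [|[|[|j]]]; [exact: H0_dim|exact: H1_dim|exact: H2_dim|exact: H_dim_vanishing].
split; first by move=> [|[|[|j]]].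
have l1 : (\rank (UV *m dmx)%R <= \rank (UE :&: kermx smx)%MS)%N.
  apply: mxrankS; apply/rV_subP => w /sub_UV_dmx[v [fv wv]]; rewrite sub_capmx; apply/andP; split.
    apply/sub_UE => i; rewrite wv; apply: fixedB.
      exact: fixed_subset (@sub_KEV i) (fv i).
    exact: fixed_subset (@sub_KEV' i) (fv (nxt i)).
  apply/sub_kermxP; rewrite mul_smx (_ : row_tri w = fun i => v i - v (nxt i)) ?tsum_nxt //.
  exact: functional_extensionality.
have l2 : (\rank (UE *m smx)%R <= \rank (avgmx n KZ))%N.
  apply: mxrankS; apply/rV_subP => w /sub_UE_smx[v [fv ->]]; apply/(@sub_avgmx n _ fin_KZ _).
  have fz i : fixed_by (@symact n) KZ (v i) by apply: fixed_subset (@sub_KZE i) (fv i).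
  by apply: fixedD => //; apply: fixedD.
have rV := mxrank_mul_ker UV dmx; have rE := mxrank_mul_ker UE smx.
rewrite !big_ord_recl big_ord0 !expr0 expr1 mul1r mulN1r addr0.
rewrite (_ : (-1) ^+ _ = 1) ?mul1r //.
exact: (euler_arith ranks (rank_tri_mx _) (rank_tri_mx _) rV rE l1 l2).
Qed.

End Cohomology.

(** * Traces *)

Definition gtr (x : gm) := giadd x.1.1 x.2.2.
Definition gdet (x : gm) := giadd (gimul x.1.1 x.2.2) (gimul giN1 (gimul x.1.2 x.2.1)).
Definition nonscalar (x : gm) := [|| ~~ gieqb x.1.2 gi0, ~~ gieqb x.2.1 gi0 | ~~ gieqb x.1.1 x.2.2].

(* Trace and determinant, up to a unit scalar, of the elements of finite order of
   PGL_2(Z[i]): two classes of involutions, and the elements of order 3 and 4. *)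
Definition class_invariants : seq (gi * gi) :=
  [:: (gi0, giN1); (gi0, (Z0, Zneg xH)); (gi1, gi1); ((Zpos xH, Zpos xH), gii)].

(** Scaling by a unit u changes (tr, det) into (u tr, u^2 det), hence the search over units. *)
Definition in_class (r : gm) (td : gi * gi) :=
  nonscalar r && has (fun u => gieqb (gtr (gscale u r)) td.1 && gieqb (gdet (gscale u r)) td.2) gunits.

(* 4 stands for the scalars. *)
Definition class_of (r : gm) : nat := if gin r [:: gone] then 4 else find (in_class r) class_invariants.

Lemma gieqb_refl x : gieqb x x.
Proof. by rewrite /gieqb !Z.eqb_refl. Qed.

Lemma toC_gi0 : toC gi0 = 0. Proof. by []. Qed.
Lemma toC_gi1 : toC gi1 = 1. Proof. by []. Qed.
Lemma toC_giN1 : toC giN1 = -1. Proof. by []. Qed.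

Lemma toC_unitX4 (u : gi) m : u \in gunits -> toC u ^+ (4 * m) = 1.
Proof.
move=> ug; rewrite exprM (_ : toC u ^+ 4 = 1) ?expr1n //.
have : all (fun u => gieqb (gimul u (gimul u (gimul u u))) gi1) gunits by [].
by move=> /allP /(_ u ug) /gieqbP e; rewrite !exprS expr0 mulr1 -!toC_mul e.
Qed.

Lemma det2_toM x : det2 (toM x) = toC (gdet x).
Proof. by rewrite /det2 /toM !mxE /gdet /= toC_add !toC_mul toC_giN1 mulN1r. Qed.
Lemma tr2_toM x : tr2 (toM x) = toC (gtr x).
Proof. by rewrite /tr2 /toM !mxE /gtr /= toC_add. Qed.

Lemma nonscalar_scale (u : gi) x : u \in gunits -> nonscalar x -> ~ exists a, toM (gscale u x) = a%:M.
Proof.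
move=> ug ns [a e]; have [v vg /gieqbP vu] := hasP (allP gunitsV u ug).
have {}e : toM x = (toC v * a)%:M.
  by rewrite -scale_scalar_mx -e toM_scale scalerA -toC_mul vu scale1r.
move: e; rewrite (_ : (toC v * a)%:M = mk2 (toC v * a) 0 0 (toC v * a)); last first.
  by rewrite -scalemx1 mk2_1 mk2Z !mulr1 !mulr0.
rewrite -{1 2}toC_gi0 => /mk2_inj[e1 /toC_inj e2 /toC_inj e3 e4].
by move: ns; rewrite /nonscalar e2 e3 (toC_inj (etrans e1 (esym e4))) !gieqb_refl.
Qed.

Section Traces.
Variable m : nat.
Local Notation n := (4 * m)%N.

Lemma tau_scale (u : gi) g : u \in gunits -> tau n (toC u *: g) = tau n g.
Proof. by move=> ug; rewrite /tau Smx_scale toC_unitX4 // scale1r. Qed.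

(** Index 4 falls off the list and meets the default [n.+1], the trace of a unit scalar when 4
    divides the degree. *)
Definition class_trace (c : nat) : Qi :=
  nth n.+1%:R [seq tau n (mk2 0 (- toC td.2) 1 (toC td.1)) | td <- class_invariants] c.

Lemma tau_class r : gin r [:: gone] || has (in_class r) class_invariants ->
  tau n (toM r) = class_trace (class_of r).
Proof.
rewrite /class_of; case: ifP => [/hasP[u ug /hasP[g]]|_ cr].
  rewrite inE => /eqP-> /geqbP e _.
  rewrite -(tau_scale _ ug) -toM_scale e toM_one /class_trace /=.
  by rewrite -[1]/(1%:M) tau_scalar expr1n mul1r.
have {}cr : has (in_class r) class_invariants := cr.
have fl := cr; rewrite has_find in fl; rewrite /class_trace (nth_map (gi0, gi0)) //.
set td := nth _ _ _; have : in_class r td by apply: nth_find.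
case/andP=> ns /hasP[u ug /andP[/gieqbP t /gieqbP d]].
rewrite -(tau_scale _ ug) -toM_scale tau_companion; last exact: nonscalar_scale.
by rewrite det2_toM tr2_toM t d.
Qed.

Lemma class_trace0 : class_trace 0 = 1.
Proof.
rewrite /class_trace /= toC_gi0 toC_giN1 (@tau_antidiag _ (2 * m)); last by lia.
by rewrite opprK expr1n.
Qed.

(** The class is that of diag(1, i), with trace the sum of i^k for 0 <= k <= 4m; all but the last
    term cancel in blocks of four. *)
Lemma class_trace3 : class_trace 3 = 1.
Proof.
have ug : gii \in gunits by [].
have -> : class_trace 3 =
  tau n (mk2 0 (- toC (gdet (gdiag gi1 gii))) 1 (toC (gtr (gdiag gi1 gii)))) by [].
rewrite -det2_toM -tr2_toM -tau_companion; last first.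
  by have := @nonscalar_scale gi1 (gdiag gi1 gii) isT isT; apply.
rewrite /toM /= toC_gi1 toC_gi0 tau_diag big_ord_recr /= toC_unitX4 //.
have i1 : toC gii - 1 != 0 by rewrite subr_eq0 -toC_gi1; apply/eqP => /toC_inj.
suff -> : \sum_(k < n) toC gii ^+ k = 0 by rewrite add0r.
by apply: (mulfI i1); rewrite -subrX1 toC_unitX4 // subrr mulr0.
Qed.

Lemma class_trace4 : class_trace 4 = n.+1%:R.
Proof. by []. Qed.

Definition units_average (k : nat) : Qi := 4%:R^-1 * \sum_(u <- gunits) toC u ^+ k.

(** A scalar u acts on S^k by u^k, so the average splits into one over the units and one over
    representatives modulo the centre. *)
Lemma trace_avgmx k R : \tr (avgmx k (map toM (gK R))) =
  units_average k * ((size R)%:R^-1 * \sum_(r <- R) tau k (toM r)).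
Proof.
rewrite /avgmx mxtraceZ size_map size_allpairs natrM invfM linear_sum /= big_map.
rewrite /gK big_allpairs_dep /= /units_average -!mulrA; congr (_ * _).
rewrite mulrCA; congr (_ * _); rewrite mulr_suml; apply: eq_bigr => u _.
rewrite mulr_sumr; apply: eq_bigr => r _.
by rewrite toM_scale Smx_scale mxtraceZ.
Qed.

Lemma sum_tau_class R : all (fun r => gin r [:: gone] || has (in_class r) class_invariants) R ->
  \sum_(r <- R) tau n (toM r) = \sum_(c <- [seq class_of r | r <- R]) class_trace c.
Proof.
move=> /allP cR; rewrite big_map !big_seq; apply: eq_bigr => r /cR; exact: tau_class.
Qed.

Lemma units_average_mul4 : units_average n = 1.
Proof.
rewrite /units_average big_seq (eq_bigr (fun=> 1)) => [|u ug]; last exact: toC_unitX4.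
rewrite -big_seq big_const_seq /= !addr0 -[_ + _](_ : 4%:R = _) ?mulVf ?Qi_natr_neq0 //.
Qed.

Definition class_average (R : seq gm) : Qi := (size R)%:R^-1 *
  \sum_(c <- [seq class_of r | r <- R]) class_trace c.

Lemma rank_avgmx R : fin_subgroup (map toM (gK R)) ->
  all (fun r => gin r [:: gone] || has (in_class r) class_invariants) R ->
  (\rank (avgmx n (map toM (gK R))))%:R = class_average R.
Proof.
move=> fK cR; rewrite -(mxrank_idempotent (avgmx_idempotent n fK)) trace_avgmx.
by rewrite units_average_mul4 mul1r sum_tau_class.
Qed.

(** In S4, the 9 counts the 6 elements of order 4 and their 3 squares, each of trace 1; the other 6
    involutions have determinant +-i, and 8 elements have order 3. *)
Lemma class_average_V0 : class_average (gRV T0) =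
  (n.+1%:R + 9%:R + 6%:R * class_trace 1 + 8%:R * class_trace 2) / 24%:R.
Proof.
rewrite /class_average (_ : [seq _ | r <- _] =
  [:: 4; 2; 1; 3; 2; 3; 3; 2; 1; 0; 3; 2; 3; 2; 2; 3; 2; 2; 1; 0; 0; 1; 1; 1]%N); last by vm_compute.
rewrite !big_cons big_nil class_trace0 class_trace3 class_trace4 mulrC; congr (_ / _).
by move: (class_trace 1) (class_trace 2) => x y; ring.
Qed.

Lemma class_average_V1 : class_average (gRV T1) =
  (n.+1%:R + 3%:R + 2%:R * class_trace 2) / 6%:R.
Proof.
rewrite /class_average (_ : [seq _ | r <- _] = [:: 4; 0; 0; 2; 2; 0]%N); last by vm_compute.
rewrite !big_cons big_nil class_trace0 class_trace4 mulrC; congr (_ / _).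
by move: (class_trace 2) => y; ring.
Qed.

Lemma class_average_V2 : class_average (gRV T2) =
  (n.+1%:R + 5%:R + 2%:R * class_trace 1) / 8%:R.
Proof.
rewrite /class_average (_ : [seq _ | r <- _] = [:: 4; 0; 3; 1; 1; 0; 3; 0]%N); last by vm_compute.
rewrite !big_cons big_nil class_trace0 class_trace3 class_trace4 mulrC; congr (_ / _).
by move: (class_trace 1) => x; ring.
Qed.

Lemma class_average_E0 : class_average (gRE T0) = (n.+1%:R + 2%:R * class_trace 2) / 3%:R.
Proof.
rewrite /class_average (_ : [seq _ | r <- _] = [:: 4; 2; 2]%N); last by vm_compute.
rewrite !big_cons big_nil class_trace4 mulrC; congr (_ / _).
by move: (class_trace 2) => y; ring.
Qed.

Lemma class_average_E1 : class_average (gRE T1) = (n.+1%:R + 1) / 2%:R.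
Proof.
rewrite /class_average (_ : [seq _ | r <- _] = [:: 4; 0]%N); last by vm_compute.
rewrite !big_cons big_nil class_trace0 class_trace4 mulrC; congr (_ / _); ring.
Qed.

Lemma class_average_E2 : class_average (gRE T2) = (n.+1%:R + class_trace 1) / 2%:R.
Proof.
rewrite /class_average (_ : [seq _ | r <- _] = [:: 4; 1]%N); last by vm_compute.
rewrite !big_cons big_nil class_trace4 mulrC; congr (_ / _).
by move: (class_trace 1) => x; ring.
Qed.

Lemma class_average_Z : class_average [:: gone] = n.+1%:R.
Proof.
rewrite /class_average (_ : [seq _ | r <- _] = [:: 4]%N); last by vm_compute.
by rewrite !big_cons big_nil class_trace4 /= invr1 mul1r addr0.
Qed.

Lemma Qi_natr_inj a b : a%:R = b%:R :> Qi -> a = b.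
Proof. by rewrite !Qi_natr => -[/eqP]; rewrite eqr_nat => /eqP. Qed.

Lemma check_classes_V i :
  all (fun r => gin r [:: gone] || has (in_class r) class_invariants) (gRV i).
Proof. by case: i; vm_compute. Qed.

Lemma check_classes_E i :
  all (fun r => gin r [:: gone] || has (in_class r) class_invariants) (gRE i).
Proof. by case: i; vm_compute. Qed.

Lemma rank_KV i : (\rank (avgmx n (KV i)))%:R = class_average (gRV i).
Proof. exact: rank_avgmx (fin_KV i) (check_classes_V i). Qed.

Lemma rank_KE i : (\rank (avgmx n (KE i)))%:R = class_average (gRE i).
Proof. exact: rank_avgmx (fin_KE i) (check_classes_E i). Qed.

Lemma rank_KZ : (\rank (avgmx n KZ))%:R = class_average [:: gone].
Proof. exact: (@rank_avgmx [:: gone] fin_KZ isT). Qed.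

Lemma ranks_mul4 :
  (\rank (avgmx n (KV T0)) + \rank (avgmx n (KV T1)) + \rank (avgmx n (KV T2)) +
   \rank (avgmx n KZ) =
   \rank (avgmx n (KE T0)) + \rank (avgmx n (KE T1)) + \rank (avgmx n (KE T2)) + 1)%N.
Proof.
apply: Qi_natr_inj; rewrite !natrD.
rewrite !rank_KV !rank_KE rank_KZ.
rewrite class_average_V0 class_average_V1 class_average_V2 class_average_E0 class_average_E1.
rewrite class_average_E2 class_average_Z.
(* The equality is formal in x, y, d: on both sides the coefficients are 1/2, 2/3, 4/3 and the
   constant term is 3/2. *)
move: (class_trace 1) (class_trace 2) (n.+1%:R) => x y d.
field; apply/and5P; split; exact: Qi_natr_neq0.
Qed.

End Traces.

Lemma units_average_eq0 n : (n %% 4 != 0)%N -> units_average n = 0.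
Proof.
move=> n4; rewrite /units_average (_ : \sum_(u <- gunits) _ = 0) ?mulr0 //.
have -> : \sum_(u <- gunits) toC u ^+ n = \sum_(u <- gunits) toC u ^+ (n %% 4).
  rewrite !big_seq; apply: eq_bigr => u ug.
  by rewrite {1}(divn_eq n 4) exprD mulnC toC_unitX4 // mul1r.
have := ltn_pmod n (isT : 0 < 4)%N; move: n4; case: (n %% 4)%N => [|[|[|[|]]]] // _ _;
  rewrite !big_cons big_nil !exprS expr0 ?mulr1 -?toC_mul addr0 -!toC_add;
  by rewrite -toC_gi0; congr toC.
Qed.

Lemma rank_avgmx_eq0 n R : fin_subgroup (map toM (gK R)) -> (n %% 4 != 0)%N ->
  \rank (avgmx n (map toM (gK R))) = 0%N.
Proof.
move=> fK n4; apply: Qi_natr_inj.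
by rewrite -(mxrank_idempotent (avgmx_idempotent n fK)) trace_avgmx units_average_eq0 // mul0r.
Qed.

Theorem theorem8p7 (n : nat) :
  euler_char_is (@symact n) (if (n %% 4 == 0)%N then 1 else 0).
Proof.
have [/eqP n4|n4] := boolP (n %% 4 == 0)%N; last first.
  apply: (@euler_char_rank n 0).
  have rV i : \rank (avgmx n (KV i)) = 0%N := rank_avgmx_eq0 (fin_KV i) n4.
  have rE i : \rank (avgmx n (KE i)) = 0%N := rank_avgmx_eq0 (fin_KE i) n4.
  have rZ : \rank (avgmx n KZ) = 0%N := rank_avgmx_eq0 fin_KZ n4.
  by rewrite !rV !rE rZ.
have -> : n = (4 * (n %/ 4))%N by rewrite mulnC {1}(divn_eq n 4) n4 addn0.
exact: (@euler_char_rank _ 1 (ranks_mul4 (n %/ 4))).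
Qed.
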